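(* Let $Y\sim \mathrm{SUN}_{d,m}(\xi,\Omega,\Delta,\tau,\Gamma)$ with mean $\mu$ and variance matrix $\Sigma$ (non-singular), let $C$ be a non-singular $d\times d$ matrix with $CC^{\top}=\Sigma$, and let $\tilde Z=C^{-1}(Y-\mu)$, so that $\tilde Z$ has the distribution of $\tilde\Lambda U_0+C^{-1}\Psi^{1/2}V$ or, equivalently, of $\tilde\Lambda U_0+\tilde\Psi^{1/2}V$, where $\Lambda,\Psi,U,V$ are as in the context, $U_0=U-\mu_1(U)$, $\tilde\Lambda=C^{-1}\Lambda$, $\tilde\Psi=C^{-1}\Psi(C^{-1})^{\top}$ (with symmetric square root $\tilde\Psi^{1/2}$) and $\Sigma_U=\mu_2(U_0)=\mathrm{var}\{U\}$. Then \begin{align*} \mu_3(\tilde Z)&=(\tilde\Lambda\otimes\tilde\Lambda)\mu_3(U_0)\tilde\Lambda^{\top},\\ \mu_4(\tilde Z)&=(\tilde\Lambda\otimes\tilde\Lambda)\mu_4(U_0)(\tilde\Lambda\otimes\tilde\Lambda)^{\top}\\ &\quad+(I_{d^2}+K_d)(\tilde\Lambda\Sigma_U\tilde\Lambda^{\top}\otimes\tilde\Psi+\tilde\Psi\otimes\tilde\Lambda\Sigma_U\tilde\Lambda^{\top}+\tilde\Psi\otimes\tilde\Psi)\\ &\quad+\mathrm{vec}(\tilde\Lambda\Sigma_U\tilde\Lambda^{\top})\mathrm{vec}(\tilde\Psi)^{\top}+\mathrm{vec}(\tilde\Psi)\mathrm{vec}(\tilde\Lambda\Sigma_U\tilde\Lambda^{\top})^{\top}+\mathrm{vec}(\tilde\Psi)\mathrm{vec}(\tilde\Psi)^{\top}.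 \end{align*} Moreover, Mardia's measures of multivariate skewness and kurtosis of $\tilde Z$ (equivalently, of $Y$) are \begin{align*} \beta_{1,d}&=\mathrm{tr}\{(\Lambda^{\top}\Sigma^{-1}\Lambda\otimes\Lambda^{\top}\Sigma^{-1}\Lambda)\,\mu_3(U_0)\,\Lambda^{\top}\Sigma^{-1}\Lambda\,\mu_3(U_0)^{\top}\}\\ &=\mathrm{vec}\{\mu_3(U_0)\}^{\top}(\tilde\Lambda^{\top}\tilde\Lambda\otimes\tilde\Lambda^{\top}\tilde\Lambda\otimes\tilde\Lambda^{\top}\tilde\Lambda)\,\mathrm{vec}\{\mu_3(U_0)\},\\ \beta_{2,d}&=\mathrm{tr}\{(\Lambda^{\top}\Sigma^{-1}\Lambda\otimes\Lambda^{\top}\Sigma^{-1}\Lambda)\mu_4(U_0)\}+2\,\mathrm{tr}(\Sigma_U\Lambda^{\top}\Sigma^{-1}\Lambda)\,\mathrm{tr}(\Psi\Sigma^{-1})\\ &\quad+\{\mathrm{tr}(\Psi\Sigma^{-1})\}^2+4\,\mathrm{tr}(\Sigma_U\Lambda^{\top}\Sigma^{-1}\Psi\Sigma^{-1}\Lambda)+2\,\mathrm{tr}(\Psi\Sigma^{-1}\Psi\Sigma^{-1}), \end{align*} where, writing $\mu_k$ for $\mu_k(U)$, $k=1,\dots,4$, \begin{align*} \mu_3(U_0)&=(I_{m^2}+K_m)\{\mu_1\otimes\mu_1\mu_1^{\top}-\mu_1\otimes\mu_2\}-\mathrm{vec}(\mu_2)\mu_1^{\top}+\mu_3,\\ \mu_4(U_0)&=-3\,\mu_1\mu_1^{\top}\otimes\mu_1\mu_1^{\top}+(I_{m^2}+K_m)\{\mu_1\mu_1^{\top}\otimes\mu_2+\mu_2\otimes\mu_1\mu_1^{\top}\\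 &\qquad-(\mu_1\otimes I_m)\mu_3^{\top}-\mu_3(\mu_1^{\top}\otimes I_m)\}\\ &\quad+\mathrm{vec}(\mu_2)(\mu_1\otimes\mu_1)^{\top}+(\mu_1\otimes\mu_1)\mathrm{vec}(\mu_2)^{\top}+\mu_4. \end{align*}
   Context: Let $d,m$ be positive integers. Let $\Omega^*=\begin{pmatrix}\bar\Omega&\Delta\\ \Delta^{\top}&\Gamma\end{pmatrix}$ be a full-rank $(d+m)\times(d+m)$ correlation matrix ($\bar\Omega$ is $d\times d$, $\Delta$ is $d\times m$, $\Gamma$ is $m\times m$), let $\tau\in\mathbb{R}^m$, $\xi\in\mathbb{R}^d$, let $\omega$ be a $d\times d$ diagonal matrix with positive diagonal elements, and $\Omega=\omega\bar\Omega\omega$. If $(X_0,X_1)\sim \mathrm{N}_{d+m}(0,\Omega^* )$, with $X_0$ of dimension $d$, $\mathrm{SUN}_{d,m}(\xi,\Omega,\Delta,\tau,\Gamma)$ denotes the distribution of $\xi+\omega Z$, where $Z$ has the distribution of $X_0$ conditional on $X_1+\tau>0$ (componentwise). Put $\Lambda=\omega\Delta\Gamma^{-1}$ and $\Psi=\Omega-\omega\Delta\Gamma^{-1}\Delta^{\top}\omega$ (which is positive definite), and let $\Psi^{1/2}$ be its symmetric positive definite square root. Let $V\sim \mathrm{N}_d(0,I_d)$ and $W\sim \mathrm{N}_m(0,\Gamma)$ be independent, and let $U$ be a random vector independent of $V$ having the distribution of $W$ conditional on $W+\tau>0$ (componentwise). Then $Y$ has the distribution of $\xi+\Lambda U+\Psi^{1/2}V$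 (additive representation), and $\mu=\mathbb{E}\{Y\}=\xi+\Lambda\mu_1(U)$. For a random (column) vector $X$: $\mu_1(X)=\mathbb{E}\{X\}$, $\mu_2(X)=\mathbb{E}\{XX^{\top}\}$, $\mu_3(X)=\mathbb{E}\{X\otimes XX^{\top}\}$, $\mu_4(X)=\mathbb{E}\{XX^{\top}\otimes XX^{\top}\}$, where $\otimes$ is the Kronecker product. The operator $\mathrm{vec}$ stacks the columns of a matrix into a single vector. The commutation matrix is $K_{pq}=\sum_{i=1}^p\sum_{j=1}^q E_{ij}\otimes E_{ij}^{\top}$, where $E_{ij}$ is the $p\times q$ matrix with 1 in position $(i,j)$ and 0 elsewhere, and $K_r=K_{rr}$; $I_r$ is the $r\times r$ identity matrix. For a $d$-dimensional random vector $Y$ with mean $\mu$ and non-singular variance matrix $\Sigma$, Mardia's measures of multivariate skewness and kurtosis are $\beta_{1,d}=\mathbb{E}\{[(Y-\mu)^{\top}\Sigma^{-1}(Y'-\mu)]^3\}$, with $Y'$ an independent copy of $Y$, and $\beta_{2,d}=\mathbb{E}\{[(Y-\mu)^{\top}\Sigma^{-1}(Y-\mu)]^2\}$. They are invariant under non-singular affine transformations.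
   Formalization: In the formula for μ_4(U_0) the term −(I_{m²}+K_m)μ_3(μ_1ᵀ⊗I_m) is false for m≥2 (e.g. Γ=I_2, τ=0) and is replaced by −μ_3(μ_1ᵀ⊗I_m)(I_{m²}+K_m), with the factor on the right; everything else is as printed. *)

(* Defs.v *)
From HB Require Import structures.
From mathcomp Require Import all_boot all_order all_algebra mxtens.
From mathcomp Require Import all_classical all_reals all_analysis.

Set Implicit Arguments.
Unset Strict Implicit.
Unset Printing Implicit Defensive.

Import Order.TTheory GRing.Theory Num.Theory.
Import numFieldNormedType.Exports.

Local Open Scope classical_set_scope.
Local Open Scope ring_scope.

(* The sigma-algebra on matrices generated by the entries, i.e. the Borel
   sigma-algebra of R^(m x n); it makes ['cV[R]_n] a [measurableType], so that
   random vectors are [{RV P >-> 'cV[R]_n}]. *)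
Section measurable_matrix.
Context {R : realType} (m n : nat).

Definition mx_entry_preimages : set (set 'M[R]_(m, n)) :=
  \bigcup_(ij in [set: 'I_m * 'I_n])
    preimage_set_system setT (fun A : 'M[R]_(m, n) => A ij.1 ij.2) measurable.

Let matrix_set0 : <<s mx_entry_preimages >> set0.
Proof. exact: sigma_algebra0. Qed.

Let matrix_setC A : <<s mx_entry_preimages >> A ->
  <<s mx_entry_preimages >> (~` A).
Proof. exact: sigma_algebraC. Qed.

Let matrix_bigcup (F : (set 'M[R]_(m, n))^nat) :
  (forall i, <<s mx_entry_preimages >> (F i)) ->
  <<s mx_entry_preimages >> (\bigcup_i (F i)).
Proof. exact: sigma_algebra_bigcup. Qed.

HB.instance Definition _ := Pointed.on 'M[R]_(m, n).
HB.instance Definition _ := @isMeasurable.Build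
  (sigma_display mx_entry_preimages) 'M[R]_(m, n)
  <<s mx_entry_preimages >> matrix_set0 matrix_setC matrix_bigcup.

End measurable_matrix.

Section matrix_notions.
Context {R : realType}.

Definition psdmx n (A : 'M[R]_n) : Prop :=
  A^T = A /\ forall x : 'cV[R]_n, 0 <= (x^T *m A *m x) 0 0.

Definition pdmx n (A : 'M[R]_n) : Prop :=
  A^T = A /\ forall x : 'cV[R]_n, x != 0 -> 0 < (x^T *m A *m x) 0 0.

Definition correlation_mx n (A : 'M[R]_n) : Prop :=
  psdmx A /\ forall i, A i i = 1.

Definition is_pd_sqrtmx n (A S : 'M[R]_n) : Prop :=
  pdmx S /\ S *m S = A.

(* [tensmx] lists index pairs lexicographically (the first factor being the
   outer one), and so must [vec] for the columns to be stacked in order.  The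
   library's [mxvec] stacks rows instead. *)
Definition vec p q (A : 'M[R]_(p, q)) : 'cV[R]_(q * p) :=
  \col_k A (mxtens_unindex k).2 (mxtens_unindex k).1.

(* The Kronecker products [x *t B] of a column, resp. row, vector with a
   matrix, with the dimension [1 * r] cast to [r]. *)
Definition tens_col p q r (x : 'cV[R]_p) (B : 'M[R]_(q, r)) :
    'M[R]_(p * q, r) :=
  castmx (erefl, mul1n r) (x *t B).

Definition tens_row p q r (x : 'rV[R]_p) (B : 'M[R]_(q, r)) :
    'M[R]_(q, p * r) :=
  castmx (mul1n q, erefl) (x *t B).

Definition commutation_mx p q : 'M[R]_(p * q, q * p) :=
  \sum_(i < p) \sum_(j < q) delta_mx i j *t (delta_mx i j : 'M[R]_(p, q))^T.

End matrix_notions.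

Section random_vectors.
Context {R : realType}.

Definition cond_prob d (T : measurableType d) (P : probability T R)
    (A B : set T) : \bar R :=
  (P (A `&` B) * ((fine (P B))^-1)%:E)%E.

Definition same_law d1 (T1 : measurableType d1) (P1 : probability T1 R)
    d2 (T2 : measurableType d2) (P2 : probability T2 R) n
    (X1 : T1 -> 'cV[R]_n) (X2 : T2 -> 'cV[R]_n) : Prop :=
  forall A, measurable A -> P1 (X1 @^-1` A) = P2 (X2 @^-1` A).

(* [X1], under [P1], has the distribution of [X2] conditional on [B] under
   [P2]. *)
Definition same_law_cond d1 (T1 : measurableType d1) (P1 : probability T1 R)
    d2 (T2 : measurableType d2) (P2 : probability T2 R) n
    (X1 : T1 -> 'cV[R]_n) (X2 : T2 -> 'cV[R]_n) (B : set T2) : Prop :=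
  forall A, measurable A -> P1 (X1 @^-1` A) = cond_prob P2 (X2 @^-1` A) B.

Definition independent_rv d (T : measurableType d) (P : probability T R) m n
    (X : T -> 'cV[R]_m) (Y : T -> 'cV[R]_n) : Prop :=
  forall A B, measurable A -> measurable B ->
    (P (X @^-1` A `&` Y @^-1` B) = P (X @^-1` A) * P (Y @^-1` B))%E.

(* The law N(0, v) on the line.  The case [v = 0] is separate because
   [normal_prob 0 0] is a uniform law and not a point mass. *)
Definition normal_law0 (v : R) (A : set R) : \bar R :=
  if v == 0 then dirac (0 : R) A else normal_prob 0 (Num.sqrt v) A.

(* X ~ N_n(0, S): every linear combination t^T X is N(0, t^T S t). *)
Definition mvnormal0 d (T : measurableType d) (P : probability T R) n
    (X : T -> 'cV[R]_n) (S : 'M[R]_n) : Prop :=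
  forall (t : 'cV[R]_n) (A : set R), measurable A ->
    P ((fun w => (t^T *m X w) 0 0) @^-1` A)
    = normal_law0 ((t^T *m S *m t) 0 0) A.

Definition pos_part_event d (T : measurableType d) m
    (X : T -> 'cV[R]_m) (tau : 'cV[R]_m) : set T :=
  [set w | forall i, 0 < (X w + tau) i 0].

(* U is distributed as W conditional on W + tau > 0, with W ~ N_m(0, Gamma). *)
Definition truncated_mvnormal0 d (T : measurableType d) (P : probability T R) m
    (U : T -> 'cV[R]_m) (tau : 'cV[R]_m) (Gamma : 'M[R]_m) : Prop :=
  exists (d0 : measure_display) (T0 : measurableType d0)
    (P0 : probability T0 R) (W : {RV P0 >-> 'cV[R]_m}),
    mvnormal0 P0 W Gamma /\ same_law_cond P P0 U W (pos_part_event W tau).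

(* Y ~ SUN_{n,m}(xi, Omega, Delta, tau, Gamma) with Omega = omega Obar omega;
   the scale is given by its factors omega and Obar. *)
Definition SUN d (T : measurableType d) (P : probability T R) n m
    (Y : T -> 'cV[R]_n) (xi : 'cV[R]_n) (omega Obar : 'M[R]_n)
    (Delta : 'M[R]_(n, m)) (tau : 'cV[R]_m) (Gamma : 'M[R]_m) : Prop :=
  exists (d0 : measure_display) (T0 : measurableType d0)
    (P0 : probability T0 R)
    (X0 : {RV P0 >-> 'cV[R]_n}) (X1 : {RV P0 >-> 'cV[R]_m}),
    mvnormal0 P0 (fun w => col_mx (X0 w) (X1 w))
      (block_mx Obar Delta Delta^T Gamma) /\
    same_law_cond P P0 Y (fun w => xi + omega *m X0 w) (pos_part_event X1 tau).

Definition mx_expectation d (T : measurableType d) (P : probability T R) p q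
    (X : T -> 'M[R]_(p, q)) : 'M[R]_(p, q) :=
  \matrix_(i, j) fine 'E_P[fun w => X w i j].

Section moments.
Context d (T : measurableType d) (P : probability T R) (n : nat).
Variable X : T -> 'cV[R]_n.

Definition mu1 : 'cV[R]_n := mx_expectation P X.

Definition mu2 : 'M[R]_n := mx_expectation P (fun w => X w *m (X w)^T).

Definition mu3 : 'M[R]_(n * n, n) :=
  mx_expectation P (fun w => tens_col (X w) (X w *m (X w)^T)).

Definition mu4 : 'M[R]_(n * n) :=
  mx_expectation P (fun w => (X w *m (X w)^T) *t (X w *m (X w)^T)).

Definition variance_mx : 'M[R]_n :=
  mx_expectation P (fun w => (X w - mu1) *m (X w - mu1)^T).

(* The independent copy of X is the second coordinate on the product space. *)
Definition mardia_skewness : R :=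
  Rintegral (P \x P)%E setT (fun w : T * T =>
    (((X w.1 - mu1)^T *m invmx variance_mx *m (X w.2 - mu1)) 0 0) ^+ 3).

Definition mardia_kurtosis : R :=
  fine 'E_P[fun w =>
    (((X w - mu1)^T *m invmx variance_mx *m (X w - mu1)) 0 0) ^+ 2].

End moments.

End random_vectors.

(* Main.v *)
Require Import Defs.
From HB Require Import structures.
From mathcomp Require Import all_boot all_order all_algebra mxtens.
From mathcomp Require Import all_classical all_reals all_analysis.
From mathcomp Require Import measurable_realfun ring lra.

Set Implicit Arguments.
Unset Strict Implicit.
Unset Printing Implicit Defensive.

Import Order.TTheory GRing.Theory Num.Theory.
Import numFieldNormedType.Exports.

Local Open Scope classical_set_scope.
Local Open Scope ring_scope.

(** The law of [Y] is that of [omega X0] shifted by [xi] and conditioned on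
    [X1 + tau > 0].  Write [omega X0] as [Lambda X1 + H], where
    [Lambda = omega Delta Gamma^-1] and the residual [H] is N(0, Psi) and
    uncorrelated with [X1].  The pair being Gaussian, [H] is independent of [X1]
    and is not affected by the conditioning, so that [Y] is distributed as
    [xi + Lambda U + H] with [U] and [H] independent (SUN_additive).  Subtracting
    the mean and applying [C^-1] gives the mixture [A + G] with
    [A = C^-1 Lambda U0] and [G] independent of it and N(0, Psit).

    Gaussian vectors are given by the laws of their linear forms, so the
    representation rests on two facts.  First, a law on column vectors is
    determined by the integrals of the waves [cos (t^T x + a)]
    (same_law_wave).  The functions that can be multiplied into every identity
    between such integrals form an algebra that is closed under bounded limits;
    it contains the waves, hence the indicators of half-spaces bounded by a
    coordinate hyperplane, hence those of all Borel sets.  Second, independent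
    centred normal variables have a normal sum (normal_mean_conv), which follows
    from completing the square in the product of the densities.  Comparing waves,
    [(omega X0, X1)] and [(Lambda W + H, W)] with independent [W] and [H] have
    the same law (same_law_regression).

    For the moments, [U] has finite fourth moments because its law is bounded by a
    multiple of a Gaussian law.  Expand products of up to four entries of [A + G];
    since [A] is centred and the odd moments of [G] vanish, only the moments of
    [A], the products of a covariance of [A] with one of [G], and the moments of
    [G] remain (mixture_mu3, mixture_mu4).  The latter are given by Isserlis'
    formula, obtained by polarization from the second and fourth moments of a
    normal variable.  Moments of [A] come from those of [U0] by linearity, and
    those of [U0] from those of [U] by expanding the products
    (mu3_center, mu4_center).

    Mardia's measures of a vector [Z] with mean 0 and unit variance matrix are
    the traces of [mu3 Z *m (mu3 Z)^T] and [mu4 Z], and those of [Y] equal those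
    of the standardized vector because [Sigma^-1 = C^-T C^-1].  The stated
    formulas then follow from trace identities for Kronecker products,
    commutation matrices and vec. *)


(** * Measurable matrices and transfer of integrals along equal laws *)

Section measurability.
Context {R : realType}.

Lemma measurable_mx_entry p q (i : 'I_p) (j : 'I_q) :
  measurable_fun setT (fun A : 'M[R]_(p, q) => A i j).
Proof.
move=> _ B mB; rewrite setTI; apply: sub_sigma_algebra.
by exists (i, j) => //; exists B => //; rewrite setTI.
Qed.

Lemma measurable_mxP d (T : measurableType d) p q (f : T -> 'M[R]_(p, q)) :
  measurable_fun setT f <->
  forall i j, measurable_fun setT (fun w => f w i j).
Proof.
split=> [mf i j|mf]; first exact: measurableT_comp (measurable_mx_entry i j) mf.
apply: (@measurability _ _ _ _ setT f (@mx_entry_preimages R p q)) => //.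
move=> _ [B [[i j] _ [C mC <-]] <-]; rewrite /= !setTI.
by have := mf i j measurableT C mC; rewrite setTI.
Qed.

Lemma measurable_mulmxl d (T : measurableType d) p q r (A : 'M[R]_(p, q))
    (f : T -> 'M[R]_(q, r)) :
  measurable_fun setT f -> measurable_fun setT (fun w => A *m f w).
Proof.
move=> /measurable_mxP mf; apply/measurable_mxP => i j.
under eq_fun do rewrite mxE.
by apply: measurable_sum => k; apply: measurable_funM.
Qed.

Lemma measurable_addmx d (T : measurableType d) p q
    (f g : T -> 'M[R]_(p, q)) :
  measurable_fun setT f -> measurable_fun setT g ->
  measurable_fun setT (fun w => f w + g w).
Proof.
move=> /measurable_mxP mf /measurable_mxP mg; apply/measurable_mxP => i j.
by under eq_fun do rewrite mxE; exact: measurable_funD.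
Qed.

Lemma measurable_col_mx d (T : measurableType d) p q
    (f : T -> 'cV[R]_p) (g : T -> 'cV[R]_q) :
  measurable_fun setT f -> measurable_fun setT g ->
  measurable_fun setT (fun w => col_mx (f w) (g w)).
Proof.
move=> /measurable_mxP mf /measurable_mxP mg; apply/measurable_mxP => i j.
by under eq_fun do rewrite mxE; case: (fintype.split i) => k; [exact: mf|exact: mg].
Qed.

Lemma measurable_usubmx p q :
  measurable_fun setT (@usubmx R p q 1).
Proof.
apply/measurable_mxP => i j.
by under eq_fun do rewrite mxE; exact: measurable_mx_entry.
Qed.

Lemma measurable_dsubmx p q :
  measurable_fun setT (@dsubmx R p q 1).
Proof.
apply/measurable_mxP => i j.
by under eq_fun do rewrite mxE; exact: measurable_mx_entry.
Qed.

End measurability.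

Section law_transfer.
Context {R : realType}.
Context d1 d2 d3 (T1 : measurableType d1) (T2 : measurableType d2)
  (S : measurableType d3).
Variables (m1 : {measure set T1 -> \bar R}) (m2 : {measure set T2 -> \bar R}).
Variables (X1 : T1 -> S) (X2 : T2 -> S).
Hypotheses (mX1 : measurable_fun setT X1) (mX2 : measurable_fun setT X2).
Hypothesis X12 :
  forall A, measurable A -> m1 (X1 @^-1` A) = m2 (X2 @^-1` A).

Lemma law_ge0_integral (f : S -> \bar R) : measurable_fun setT f ->
  (forall y, 0 <= f y)%E -> (\int[m1]_x f (X1 x) = \int[m2]_x f (X2 x))%E.
Proof.
move=> mf f0.
transitivity (\int[pushforward m1 X1]_y f y)%E.
  by rewrite ge0_integral_pushforward.
rewrite (eq_measure_integral (pushforward m2 X2)); last first.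
  by move=> A mA _; exact: X12.
by rewrite ge0_integral_pushforward.
Qed.

(** The integral of a signed function is the difference of the integrals of its
    positive and negative parts, so the nonnegative case suffices even when
    [f] is not integrable. *)
Lemma law_integral (f : S -> \bar R) : measurable_fun setT f ->
  (\int[m1]_x f (X1 x) = \int[m2]_x f (X2 x))%E.
Proof.
move=> mf; rewrite integralE [RHS]integralE; congr (_ - _)%E.
- rewrite (funepos_comp f X1) (funepos_comp f X2).
  by apply: law_ge0_integral => //; exact: measurable_funepos.
- rewrite (funeneg_comp f X1) (funeneg_comp f X2).
  by apply: law_ge0_integral => //; exact: measurable_funeneg.
Qed.

Lemma law_Rintegral (f : S -> R) : measurable_fun setT f ->
  \int[m1]_x f (X1 x) = \int[m2]_x f (X2 x).
Proof.
by move=> mf; congr fine; apply: (@law_integral (EFin \o f));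
  exact/measurable_EFinP.
Qed.

Lemma law_integrable (f : S -> R) : measurable_fun setT f ->
  m1.-integrable setT (fun x => (f (X1 x))%:E) ->
  m2.-integrable setT (fun x => (f (X2 x))%:E).
Proof.
move=> mf /integrableP[_ intf]; apply/integrableP; split.
  by apply/measurable_EFinP; exact: measurableT_comp mf mX2.
rewrite -(@law_ge0_integral (fun y => `|f y|%:E)) //.
by apply/measurable_EFinP; exact: measurableT_comp.
Qed.

End law_transfer.

(** * Trigonometric moments determine the law of a random vector *)

Section sign_approximation.
Context {R : realType}.

(** The cubic [y (3 - y^2) / 2] maps [-1, 1] to itself, fixes -1, 0 and 1 and
    pushes all other points away from 0, so that its iterates are polynomials
    converging boundedly to the sign function on [-1, 1]. *)
Definition sg_step (y : R) : R := y * (3 - y ^+ 2) / 2.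

Definition sg_approx k (y : R) : R := iter k sg_step y.

Lemma sg_stepN y : sg_step (- y) = - sg_step y.
Proof. by rewrite /sg_step; field. Qed.

Lemma sg_approxN k y : sg_approx k (- y) = - sg_approx k y.
Proof. by elim: k => //= k IH; rewrite /sg_approx/= -/(sg_approx k _) IH sg_stepN. Qed.

Lemma sg_approx0 k : sg_approx k 0 = 0.
Proof.
by elim: k => //= k IH; rewrite /sg_approx/= -/(sg_approx k _) IH /sg_step !mul0r.
Qed.

(** The step multiplies the distance to 1 by [1 - (z + z^2) / 2], which is at
    most [1 - y / 2] as long as [y <= z]. *)
Lemma sg_approx_itv k y : 0 < y <= 1 ->
  [/\ y <= sg_approx k y, sg_approx k y <= 1 &
      1 - sg_approx k y <= (1 - y / 2) ^+ k].
Proof.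
move=> /andP[y0 y1]; elim: k => [|k [IH1 IH2 IH3]].
  by rewrite expr0; split => //; rewrite /sg_approx/=; lra.
rewrite /sg_approx iterS -/(sg_approx k y) exprS.
move: (sg_approx k y) IH1 IH2 IH3 => z yz z1 zk.
have z2 : 0 <= z ^+ 2 by rewrite sqr_ge0.
have z21 : z ^+ 2 <= 1 by rewrite expr_le1// (le_trans (ltW y0)).
have e0 : 0 <= (1 - y / 2) ^+ k by rewrite exprn_ge0//; lra.
rewrite /sg_step; split.
- suff : 0 <= z * (1 - z ^+ 2) by lra.
  by rewrite mulr_ge0//; lra.
- suff : 0 <= (1 - z) ^+ 2 * (2 + z) by lra.
  by rewrite mulr_ge0 ?sqr_ge0//; lra.
- have -> : 1 - z * (3 - z ^+ 2) / 2 = (1 - (z + z ^+ 2) / 2) * (1 - z).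
    by field.
  by apply: ler_pM => //; lra.
Qed.

Lemma cvg_sg_approx y : `|y| <= 1 -> sg_approx k y @[k --> \oo] --> Num.sg y.
Proof.
have pos x : 0 < x <= 1 -> sg_approx k x @[k --> \oo] --> (1 : R).
  move=> x01; have /andP[x0 x1] := x01.
  apply: (@squeeze_cvgr _ _ _ _ (fun k => 1 - (1 - x / 2) ^+ k) (cst 1)).
  - by near=> k; have [_ ? ?] := sg_approx_itv k x01; rewrite /cst; lra.
  - rewrite -[X in _ --> X]subr0; apply: cvgB; first exact: cvg_cst.
    by apply: cvg_expr; rewrite ger0_norm; lra.
  - exact: cvg_cst.
move=> y1; have [y0|y0|->] := ltgtP y 0.
- rewrite ltr0_sg// -(opprK y).
  under eq_cvg do rewrite sg_approxN.
  by apply: cvgN; apply: pos; move: y1; rewrite ltr0_norm//; lra.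
- by rewrite gtr0_sg//; apply: pos; move: y1; rewrite gtr0_norm//; lra.
- by under eq_cvg do rewrite sg_approx0; rewrite sgr0; exact: cvg_cst.
Unshelve. all: end_near. Qed.

Lemma sg_approx_bound k y : `|y| <= 1 -> `|sg_approx k y| <= 1.
Proof.
have pos x : 0 < x <= 1 -> `|sg_approx k x| <= 1.
  move=> x01; have /andP[x0 x1] := x01.
  by have [? ? _] := sg_approx_itv k x01; rewrite ger0_norm//; lra.
move=> y1; have [y0|y0|->] := ltgtP y 0.
- rewrite -(opprK y) sg_approxN normrN; apply: pos.
  by move: y1; rewrite ltr0_norm//; lra.
- by apply: pos; move: y1; rewrite gtr0_norm//; lra.
- by rewrite sg_approx0 normr0.
Qed.

(** Dilating the sine moves all its zeros but the origin to infinity. *)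
Lemma cvg_sg_sin (x : R) :
  Num.sg (sin (x / k.+1%:R)) @[k --> \oo] --> Num.sg x.
Proof.
suff H (y : R) : 0 < y -> \forall k \near \oo, Num.sg (sin (y / k.+1%:R)) = 1.
  have [x0|x0|->] := ltgtP x 0.
  - rewrite ltr0_sg//; apply: cvg_near_cst.
    have : 0 < - x by rewrite oppr_gt0.
    move=> /H; apply: filterS => k.
    by rewrite mulNr sinN sgrN => /eqP; rewrite eqr_oppLR => /eqP.
  - by rewrite gtr0_sg//; apply: cvg_near_cst; exact: H.
  - by apply: cvg_near_cst; apply: nearW => k; rewrite mul0r sin0 sgr0.
move=> y0; apply: (@filterS _ \oo _ (fun k => y <= k%:R)); last first.
  exact: nbhs_infty_ger.
move=> k yk; rewrite gtr0_sg// sin_gt0_pi//.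
rewrite divr_gt0//= ltr_pdivrMr//.
have pi1 : (1 : R) <= pi by have := pi_ge2 R; lra.
apply: (@lt_le_trans _ _ k.+1%:R); last by rewrite ler_peMl.
by rewrite (le_lt_trans yk)// ltr_nat.
Qed.

End sign_approximation.

Section trigonometric_moments.
Context {R : realType} (n : nat).
Local Notation V := 'cV[R]_n.
Variables (mu1 mu2 : probability V R).
Local Notation wave t a := (fun x : V => cos ((t^T *m x) 0 0 + a)).

Definition bounded_meas (f : V -> R) :=
  measurable_fun setT f /\ exists M, forall x, `|f x| <= M.

(** Knowing that [f] has the same integral under [mu1] and [mu2] does not pass
    to products of such functions.  Asking it of [f] times every wave does not
    either, but the functions that can be multiplied into this class form an
    algebra by construction, and the addition formula of the cosine puts the
    waves themselves into this algebra. *)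
Definition same_trig_moments (f : V -> R) := bounded_meas f /\
  forall (t : V) a, \int[mu1]_x (f x * wave t a x) = \int[mu2]_x (f x * wave t a x).

Definition multiplier (h : V -> R) := bounded_meas h /\
  forall f, same_trig_moments f -> same_trig_moments (fun x => h x * f x).

Lemma bounded_meas_cst c : bounded_meas (fun=> c).
Proof. by split; [exact: measurable_cst|exists `|c|]. Qed.

Lemma bounded_measD f g : bounded_meas f -> bounded_meas g ->
  bounded_meas (fun x => f x + g x).
Proof.
move=> [mf [M fM]] [mg [N gN]]; split; first exact: measurable_funD.
by exists (M + N) => x; rewrite (le_trans (ler_normD _ _))// lerD.
Qed.

Lemma bounded_measM f g : bounded_meas f -> bounded_meas g ->
  bounded_meas (fun x => f x * g x).
Proof.
move=> [mf [M fM]] [mg [N gN]]; split; first exact: measurable_funM.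
by exists (M * N) => x; rewrite normrM ler_pM.
Qed.

Lemma measurable_wave (t : V) a : measurable_fun setT (wave t a).
Proof.
apply: measurableT_comp.
  by apply: continuous_measurable_fun; exact: continuous_cos.
apply: measurable_funD => //.
apply: (measurableT_comp (measurable_mx_entry ord0 ord0)).
by apply: measurable_mulmxl; exact: measurable_id.
Qed.

Lemma bounded_wave (t : V) a : bounded_meas (wave t a).
Proof. by split; [exact: measurable_wave|exists 1 => x; exact: cos_max]. Qed.

Lemma bounded_meas_integrable (P : probability V R) f :
  bounded_meas f -> P.-integrable setT (EFin \o f).
Proof.
move=> [mf [M fM]].
apply: (@le_integrable _ _ _ _ setT measurableT _ (EFin \o cst M)).
- exact/measurable_EFinP.
- by move=> x _; rewrite /= lee_fin (le_trans (fM x))// ler_norm.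
- exact: finite_measure_integrable_cst.
Qed.

Lemma bounded_meas_lim (f_ : nat -> V -> R) f M :
  (forall k, bounded_meas (f_ k)) -> (forall k x, `|f_ k x| <= M) ->
  (forall x, f_ k x @[k --> \oo] --> f x) -> bounded_meas f.
Proof.
move=> mf fM ff; split.
  apply/measurable_EFinP.
  apply: (emeasurable_fun_cvg (fun k x => (f_ k x)%:E)).
    by move=> k; apply/measurable_EFinP; case: (mf k).
  by move=> x _; apply/cvg_EFin; [exact: nearW|exact: ff].
exists M => x; have /cvg_norm H := ff x.
apply: (cvgr_to_le H); exact: nearW.
Qed.



Lemma same_trigD f g : same_trig_moments f -> same_trig_moments g ->
  same_trig_moments (fun x => f x + g x).
Proof.
move=> [bf Ef] [bg Eg]; split; first exact: bounded_measD.
move=> t a.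
have H (mu : probability V R) : \int[mu]_x ((f x + g x) * wave t a x) =
    \int[mu]_x (f x * wave t a x) + \int[mu]_x (g x * wave t a x).
  rewrite -RintegralD//.
  - by apply: eq_Rintegral => x _; rewrite mulrDl.
  - by apply: bounded_meas_integrable; apply: bounded_measM => //;
      exact: bounded_wave.
  - by apply: bounded_meas_integrable; apply: bounded_measM => //;
      exact: bounded_wave.
by rewrite !H Ef Eg.
Qed.

Lemma same_trigZ c f : same_trig_moments f ->
  same_trig_moments (fun x => c * f x).
Proof.
move=> [bf Ef]; split.
  by apply: bounded_measM => //; exact: bounded_meas_cst.
move=> t a.
have H (mu : probability V R) : \int[mu]_x (c * f x * wave t a x) =
    c * \int[mu]_x (f x * wave t a x).
  rewrite -RintegralZl//.
  - by apply: eq_Rintegral => x _; rewrite mulrA.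
  - by apply: bounded_meas_integrable; apply: bounded_measM => //;
      exact: bounded_wave.
by rewrite !H Ef.
Qed.

Lemma same_trig_wave (s : V) b f : same_trig_moments f ->
  same_trig_moments (fun x => wave s b x * f x).
Proof.
move=> [bf Ef]; split.
  by apply: bounded_measM => //; exact: bounded_wave.
move=> t a.
(* cos u cos v = (cos (u + v) + cos (u - v)) / 2 *)
have H (mu : probability V R) :
    \int[mu]_x (wave s b x * f x * wave t a x) =
    2^-1 * (\int[mu]_x (f x * wave (s + t) (b + a) x) +
            \int[mu]_x (f x * wave (s - t) (b - a) x)).
  rewrite -RintegralD//; first last.
  - by apply: bounded_meas_integrable; apply: bounded_measM => //;
      exact: bounded_wave.
  - by apply: bounded_meas_integrable; apply: bounded_measM => //;
      exact: bounded_wave.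
  rewrite -RintegralZl//; last first.
    apply: bounded_meas_integrable; apply: bounded_measD;
      apply: bounded_measM => //; exact: bounded_wave.
  apply: eq_Rintegral => x _.
  have -> : ((s + t)^T *m x) 0 0 + (b + a) =
      ((s^T *m x) 0 0 + b) + ((t^T *m x) 0 0 + a).
    by rewrite linearD/= mulmxDl [in LHS]mxE; ring.
  have -> : ((s - t)^T *m x) 0 0 + (b - a) =
      ((s^T *m x) 0 0 + b) - ((t^T *m x) 0 0 + a).
    rewrite linearB/= mulmxBl; set u := s^T *m x; set v := t^T *m x.
    by rewrite [in LHS]mxE; rewrite [in LHS](_ : (- v) 0 0 = - v 0 0) ?mxE//; ring.
  move: (_ + b) (_ + a) => u v; by rewrite cosD cosB; field.
by rewrite !H !Ef.
Qed.

Lemma same_trig_lim (f_ : nat -> V -> R) f M :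
  (forall k, same_trig_moments (f_ k)) -> (forall k x, `|f_ k x| <= M) ->
  (forall x, f_ k x @[k --> \oo] --> f x) -> same_trig_moments f.
Proof.
move=> Sf fM ff.
have bf : bounded_meas f.
  by apply: (bounded_meas_lim _ fM ff) => k; case: (Sf k).
split => // t a.
have H (mu : probability V R) :
    \int[mu]_x (f_ k x * wave t a x) @[k --> \oo] -->
    \int[mu]_x (f x * wave t a x).
  have bfk k : bounded_meas (fun x => f_ k x * wave t a x).
    by apply: bounded_measM; [case: (Sf k)|exact: bounded_wave].
  have bft : bounded_meas (fun x => f x * wave t a x).
    by apply: bounded_measM => //; exact: bounded_wave.
  apply: fine_cvg; rewrite fineK; last first.
    by apply: integrable_fin_num => //; exact: (bounded_meas_integrable mu bft).
  have [] := @dominated_convergence _ _ _ mu setT measurableT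
    (fun k x => (f_ k x * wave t a x)%:E) (fun x => (f x * wave t a x)%:E)
    (fun=> M%:E).
  - by move=> k; apply/measurable_EFinP; case: (bfk k).
  - by apply/measurable_EFinP; case: bft.
  - apply: aeW => x _; apply/cvg_EFin; first exact: nearW.
    by apply: cvgM; [exact: ff|exact: cvg_cst].
  - exact: (@finite_measure_integrable_cst _ _ _ mu setT M measurableT).
  - apply: aeW => x k _; rewrite /= lee_fin normrM.
    rewrite -[leRHS]mulr1; apply: ler_pM => //; exact: cos_max.
  - by [].
have := H mu1; under eq_cvg do rewrite (Sf _).2.
by move=> H1; exact: cvg_unique H1 (H mu2).
Qed.

Lemma multiplier_cst c : multiplier (fun=> c).
Proof.
by split; [exact: bounded_meas_cst|move=> f; exact: same_trigZ].
Qed.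

Lemma multiplierD f g : multiplier f -> multiplier g ->
  multiplier (fun x => f x + g x).
Proof.
move=> [bf Ef] [bg Eg]; split; first exact: bounded_measD.
move=> h Sh; under eq_fun do rewrite mulrDl.
by apply: same_trigD; [exact: Ef|exact: Eg].
Qed.

Lemma multiplierM f g : multiplier f -> multiplier g ->
  multiplier (fun x => f x * g x).
Proof.
move=> [bf Ef] [bg Eg]; split; first exact: bounded_measM.
by move=> h Sh; under eq_fun do rewrite -mulrA; apply: Ef; exact: Eg.
Qed.

Lemma multiplierB f g : multiplier f -> multiplier g ->
  multiplier (fun x => f x - g x).
Proof.
move=> Mf Mg; under eq_fun do rewrite -mulN1r.
by apply: multiplierD => //; apply: multiplierM => //; exact: multiplier_cst.
Qed.

Lemma multiplier_wave (t : V) a : multiplier (wave t a).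
Proof.
by split; [exact: bounded_wave|move=> f; exact: same_trig_wave].
Qed.

Lemma multiplier_lim (h_ : nat -> V -> R) h M :
  (forall k, multiplier (h_ k)) -> (forall k x, `|h_ k x| <= M) ->
  (forall x, h_ k x @[k --> \oo] --> h x) -> multiplier h.
Proof.
move=> mh hM hh; split.
  by apply: (bounded_meas_lim _ hM hh) => k; case: (mh k).
move=> f Sf; have [[_ [N fN]] _] := Sf.
apply: (@same_trig_lim (fun k x => h_ k x * f x) _ (M * N)).
- by move=> k; exact: (mh k).2.
- by move=> k x; rewrite normrM; apply: ler_pM.
- by move=> x; apply: cvgM; [exact: hh|exact: cvg_cst].
Qed.

(** For a union, the partial products of the indicators of the complements are
    multipliers, and at each point they are eventually constant. *)
Lemma multiplier_sigma_algebra :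
  sigma_algebra setT [set A | multiplier (\1_A : V -> R)].
Proof.
split => /=.
- by rewrite indic0; exact: multiplier_cst.
- move=> A MA; rewrite setTD (_ : \1_(~` A) = fun x => 1 - \1_A x).
    by apply: multiplierB => //; exact: multiplier_cst.
  by apply/funext => x; rewrite !indicE in_setC; case: (x \in A);
    rewrite /= ?subrr ?subr0.
- move=> F MF.
  have MFn k : multiplier (fun x => 1 - \prod_(i < k) (1 - \1_(F i) x)).
    apply: multiplierB; first exact: multiplier_cst.
    elim: k => [|k IH].
      by under eq_fun do rewrite big_ord0; exact: multiplier_cst.
    under eq_fun do rewrite big_ord_recr/=.
    by apply: multiplierM => //; apply: multiplierB => //; exact: multiplier_cst.
  apply: (multiplier_lim MFn (M := 1)).
    move=> k x; suff /andP[? ?] :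
        0 <= \prod_(i < k) (1 - \1_(F i) x : R) <= 1 by rewrite ler_norml; lra.
    elim: k => [|k /andP[IH0 IH1]]; first by rewrite big_ord0 lexx ler01.
    rewrite big_ord_recr/= indicE; case: (x \in F k) => /=.
      by rewrite subrr mulr0 lexx ler01.
    by rewrite subr0 mulr1 IH0.
  move=> x; have [[k _ Fkx]|Fx] := pselect ((\bigcup_k F k) x).
    rewrite indicE mem_set/=; last by exists k.
    apply: cvg_near_cst; exists k.+1 => // j /= kj.
    rewrite (bigD1 (Ordinal kj))//= indicE mem_set// subrr mul0r subr0//.
  rewrite indicE memNset//=.
  apply: cvg_near_cst; apply: nearW => k.
  rewrite big1 ?subrr// => i _; rewrite indicE memNset ?subr0// => Fi.
  by apply: Fx; exists i.
Qed.

(** The sign of a coordinate is a twofold bounded limit of polynomials in waves: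
    first iterate the cubic on a dilated sine, then let the dilation grow. *)
Lemma multiplier_ray (j : 'I_n) (a : R) :
  multiplier (\1_[set x : V | a < x j 0]).
Proof.
pose u k (x : V) := sin ((x j 0 - a) / k.+1%:R).
have Mu k : multiplier (u k).
  have -> : u k = wave (k.+1%:R^-1 *: (delta_mx j 0 : V))
                       (- a / k.+1%:R - pi / 2).
    apply/funext => x; rewrite /u addrA cosBpihalf linearZ/= -scalemxAl mxE.
    by rewrite trmx_delta -rowE mxE; congr sin; ring.
  exact: multiplier_wave.
have u1 k x : `|u k x| <= 1 by exact: sin_max.
have Msg k : multiplier (fun x => Num.sg (u k x)).
  apply: (@multiplier_lim (fun i x => sg_approx i (u k x)) _ 1).
  - elim => [|i IH]; first exact: Mu.
    rewrite /sg_approx/=.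
    apply: multiplierM; last exact: multiplier_cst.
    apply: multiplierM => //; apply: multiplierB; first exact: multiplier_cst.
    by under eq_fun do rewrite expr2; exact: multiplierM.
  - by move=> i x; exact: sg_approx_bound.
  - by move=> x; exact: cvg_sg_approx.
have Ms : multiplier (fun x : V => Num.sg (x j 0 - a)).
  apply: (multiplier_lim Msg (M := 1)).
  - by move=> k x; rewrite normr_sg; case: eqP.
  - by move=> x; exact: cvg_sg_sin.
rewrite (_ : \1__ = fun x : V =>
    (Num.sg (x j 0 - a) + Num.sg (x j 0 - a) * Num.sg (x j 0 - a)) * 2^-1).
  apply: multiplierM; last exact: multiplier_cst.
  by apply: multiplierD => //; exact: multiplierM.
apply/funext => x; rewrite indicE.
have [ax|ax|ax] := ltgtP a (x j 0).
- by rewrite mem_set//= gtr0_sg ?subr_gt0//; field.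
- by rewrite memNset/=; [rewrite ltr0_sg ?subr_lt0//; field|rewrite ltNge ltW].
- by rewrite memNset/=; [rewrite ax subrr sgr0; field|rewrite ax ltxx].
Qed.

Lemma multiplier_measurable (A : set V) : measurable A -> multiplier (\1_A).
Proof.
move: A; apply: smallest_sub; first exact: multiplier_sigma_algebra.
move=> _ [[i j] _ [B mB <-]]; rewrite /= setTI {j}(ord1 j).
have [s0 sC sU] := multiplier_sigma_algebra.
pose G := [set B : set R | multiplier (\1_((fun x : V => x i 0) @^-1` B))].
suff : measurable `<=` G by apply.
rewrite [X in X `<=` _](@RGenOInfty.measurableE R).
apply: smallest_sub; first split.
- by rewrite /G/= preimage_set0.
- by move=> C GC; rewrite setTD /G/= preimage_setC -setTD; exact: sC.
- by move=> F GF; rewrite /G/= preimage_bigcup; exact: sU.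
move=> _ [a ->]; rewrite /G/= (_ : _ @^-1` _ = [set x : V | a < x i 0]).
  exact: multiplier_ray.
by apply/seteqP; split => x /=; rewrite in_itv/= andbT.
Qed.

(** Indicators of Borel sets are multipliers, and the constant 1 has the same
    trigonometric moments under both laws. *)
Lemma eq_probability_wave :
  (forall (t : V) a, \int[mu1]_x wave t a x = \int[mu2]_x wave t a x) ->
  forall A, measurable A -> mu1 A = mu2 A.
Proof.
move=> E A mA.
have S1 : same_trig_moments (fun=> 1).
  split; first exact: bounded_meas_cst.
  by move=> t a; under eq_Rintegral do rewrite mul1r;
    under [RHS]eq_Rintegral do rewrite mul1r; exact: E.
have [_ /(_ 0 0)] := (multiplier_measurable mA).2 _ S1.
have H (mu : probability V R) :
    \int[mu]_x (\1_A x * 1 * wave 0 0 x) = fine (mu A).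
  rewrite -[A in RHS]setIT -integral_indic//; apply: eq_Rintegral => x _.
  by rewrite trmx0 mul0mx mxE addr0 cos0 !mulr1.
rewrite !H => /eqP; rewrite -eqe !fineK ?fin_num_measure//.
by move/eqP.
Qed.

End trigonometric_moments.

Lemma same_law_wave (R : realType) d1 d2 (T1 : measurableType d1)
    (T2 : measurableType d2) (P1 : probability T1 R) (P2 : probability T2 R) n
    (X1 : T1 -> 'cV[R]_n) (X2 : T2 -> 'cV[R]_n) :
  measurable_fun setT X1 -> measurable_fun setT X2 ->
  (forall (t : 'cV[R]_n) a, \int[P1]_w cos ((t^T *m X1 w) 0 0 + a) =
                \int[P2]_w cos ((t^T *m X2 w) 0 0 + a)) ->
  same_law P1 P2 X1 X2.
Proof.
move=> mX1 mX2 E A mA.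
pose Y1 := mfun_Sub (mem_set mX1 : X1 \in mfun).
pose Y2 := mfun_Sub (mem_set mX2 : X2 \in mfun).
apply: (@eq_probability_wave _ _ (distribution P1 Y1) (distribution P2 Y2)) => //.
move=> t a.
have id_meas : measurable_fun setT (@id 'cV[R]_n) by exact: measurable_id.
rewrite -(law_Rintegral (m2 := distribution P1 Y1) mX1 id_meas
  (fun A _ => erefl) (measurable_wave t a)).
rewrite -(law_Rintegral (m2 := distribution P2 Y2) mX2 id_meas
  (fun A _ => erefl) (measurable_wave t a)).
exact: E.
Qed.

(** * Moments and convolution of centred normal laws *)

Section density.
Context {R : realType} d (T : measurableType d).
Variables (mu nu : {measure set T -> \bar R}) (g : T -> R).
Hypotheses (mg : measurable_fun setT g) (g0 : forall x, 0 <= g x).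
Hypothesis nuE : forall A, measurable A -> nu A = (\int[mu]_(x in A) (g x)%:E)%E.

Import HBNNSimple.

Let integral_density_nnsfun (f : {nnsfun T >-> R}) :
  (\int[nu]_x (f x)%:E = \int[mu]_x (f x * g x)%:E)%E.
Proof.
under [LHS]eq_integral do rewrite fimfunE -fsumEFin//.
rewrite [LHS]ge0_integral_fsum//; last 2 first.
  - by move=> r; exact/measurable_EFinP/measurableT_comp.
  - by move=> n x _; rewrite EFinM nnfun_muleindic_ge0.
under [RHS]eq_integral.
  move=> x _; rewrite mulrC EFinM fimfunE -fsumEFin// ge0_mule_fsumr; last first.
    by move=> r; rewrite EFinM nnfun_muleindic_ge0.
  over.
have mfg r : measurable_fun setT
    (fun x => (g x)%:E * (r * \1_(f @^-1` [set r]) x)%:E)%E.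
  apply: emeasurable_funM; first exact/measurable_EFinP.
  by apply/measurable_EFinP; apply: measurableT_comp.
rewrite [RHS]ge0_integral_fsum//; last first.
  move=> r x _; rewrite mule_ge0 ?lee_fin//.
  by have := nnfun_muleindic_ge0 f r x; rewrite -EFinM lee_fin.
apply: eq_fsbigr => r _.
have [r0|r0] := leP 0 r; last first.
  rewrite integral0_eq; last first.
    by move=> x _; rewrite preimage_nnfun0// indic0 mulr0.
  rewrite integral0_eq// => x _.
  by rewrite preimage_nnfun0// indic0 mulr0 mule0.
rewrite integralZl_indic_nnsfun//= integral_indic// setIT nuE//.
under [RHS]eq_integral do rewrite EFinM muleCA.
rewrite ge0_integralZl//.
- by congr (_ * _)%E; rewrite integral_mkcond; apply: eq_integral => x _;
    rewrite patchE indicE; case: ifPn; rewrite ?mule1 ?mule0.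
- apply: emeasurable_funM; first exact/measurable_EFinP.
  exact/measurable_EFinP/measurable_indic.
- by move=> x _; rewrite mule_ge0 ?lee_fin// indicE.
Qed.

(** A measure given on sets by a density has this density as an integrator, by
    monotone approximation from simple functions. *)
Lemma ge0_integral_density (f : T -> \bar R) : measurable_fun setT f ->
  (forall x, 0 <= f x)%E ->
  (\int[nu]_x f x = \int[mu]_x (f x * (g x)%:E))%E.
Proof.
move=> mf f0.
have Ef0 x : setT x -> (0 <= f x)%E by [].
pose f_ := nnsfun_approx measurableT mf.
transitivity (lim (\int[nu]_x (f_ n x)%:E @[n --> \oo])%E).
  rewrite -monotone_convergence//=.
  - apply: eq_integral => x _; apply/esym/cvg_lim => //=.
    exact: (cvg_nnsfun_approx measurableT mf Ef0).
  - by move=> n; exact/measurable_EFinP.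
  - by move=> n ? _; rewrite lee_fin.
  - by move=> ? _ ? ? mn; rewrite lee_fin; exact/lefP/nd_nnsfun_approx.
transitivity (lim (\int[mu]_x (f_ n x * g x)%:E @[n --> \oo])%E); last first.
  rewrite -monotone_convergence//=.
  - apply: eq_integral => x _; apply: (@cvg_lim _) => [//|].
    have H : ((f_ n x)%:E * (g x)%:E)%E @[n --> \oo] --> (f x * (g x)%:E)%E.
      by apply: cvgeZr => //; exact: (cvg_nnsfun_approx measurableT mf Ef0).
    exact: H.
  - by move=> n; apply/measurable_EFinP; apply: measurable_funM.
  - by move=> n ? _; rewrite lee_fin mulr_ge0.
  - move=> ? _ ? ? mn; rewrite lee_fin ler_wpM2r//.
    exact/lefP/nd_nnsfun_approx.
by apply: congr_lim; apply/funext => n; exact: integral_density_nnsfun.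
Qed.

End density.

Section normal_integrals.
Context {R : realType}.
Local Notation leb := (@lebesgue_measure R).
Implicit Types (a s x : R).

Lemma ge0_integral_normal m s (f : R -> R) : measurable_fun setT f ->
  (forall x, 0 <= f x) ->
  (\int[normal_prob m s]_x (f x)%:E = \int[leb]_x (f x * normal_pdf m s x)%:E)%E.
Proof.
move=> mf f0; rewrite (ge0_integral_density (mu := leb) (g := normal_pdf m s))//.
- exact: measurable_normal_pdf.
- by move=> x; exact: normal_pdf_ge0.
- exact/measurable_EFinP.
Qed.

Lemma normal_peakV a s : 0 < a -> 0 < s ->
  normal_peak (s / a) = a * normal_peak s.
Proof.
move=> a0 s0; rewrite /normal_peak.
rewrite (_ : (s / a) ^+ 2 * pi *+ 2 = a ^- 2 * (s ^+ 2 * pi *+ 2)); last first.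
  by rewrite expr_div_n; ring.
rewrite sqrtrM ?invr_ge0 ?sqr_ge0// sqrtrV ?sqr_ge0// sqrtr_sqr gtr0_norm//.
by rewrite invfM invrK.
Qed.

(** Tilting a centred normal density by the exponential of a multiple of the
    square only changes its variance. *)
Lemma normal_pdf_tilt a s x : 0 < a -> 0 < s ->
  expR ((1 - a ^+ 2) * x ^+ 2 / (s ^+ 2 *+ 2)) * normal_pdf 0 s x =
  a^-1 * normal_pdf 0 (s / a) x.
Proof.
move=> a0 s0; have sa0 : 0 < s / a by rewrite divr_gt0.
rewrite !normal_pdfE ?gt_eqF// normal_peakV// !mulrA mulVf ?gt_eqF// mul1r.
rewrite mulrC mulrCA mulrC mulrAC mulrC mulrA /normal_fun -mulrA -expRD.
congr (_ * expR _).
by rewrite !subr0; field; rewrite ?gt_eqF.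
Qed.

Lemma ge0_integral_normal_tilt a s (h : R -> R) : 0 < a -> 0 < s ->
  measurable_fun setT h -> (forall x, 0 <= h x) ->
  (\int[normal_prob 0 s]_x
      (h x * expR ((1 - a ^+ 2) * x ^+ 2 / (s ^+ 2 *+ 2)))%:E =
   a^-1%:E * \int[normal_prob 0 (s / a)]_x (h x)%:E)%E.
Proof.
move=> a0 s0 mh h0.
have mh' : measurable_fun setT (fun x => h x * normal_pdf 0 (s / a) x).
  by apply: measurable_funM => //; exact: measurable_normal_pdf.
rewrite !ge0_integral_normal//.
- rewrite -ge0_integralZl//.
  + apply: eq_integral => x _; rewrite -EFinM; congr EFin.
    by rewrite -mulrA normal_pdf_tilt// mulrCA.
  + exact/measurable_EFinP.
  + by move=> x _; rewrite lee_fin mulr_ge0// normal_pdf_ge0.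
  + by rewrite lee_fin invr_ge0 ltW.
- apply: measurable_funM => //; apply: measurableT_comp => //.
  by apply: measurable_funM => //; apply: measurable_funM.
- by move=> x; rewrite mulr_ge0// expR_ge0.
Qed.

(** Integrating [h x * (1 + y) <= h x * expR y] with [y] the exponent of the tilt
    bounds the integral of [x^2 h x] from above when [a < 1] and from below when
    [a > 1], the right-hand side being known; both bounds tend to the same value
    as [a] tends to 1.  This computes even moments recursively without
    differentiating under the integral sign. *)
Lemma ge0_normal_integral_sqr (h : R -> R) p (K : R) :
  measurable_fun setT h -> (forall x, 0 <= h x) ->
  (forall s, 0 < s -> (\int[normal_prob 0 s]_x (h x)%:E = (K * s ^+ p)%:E)%E) ->
  forall s, 0 < s ->
  (\int[normal_prob 0 s]_x (x ^+ 2 * h x)%:E = (p.+1%:R * K * s ^+ p.+2)%:E)%E.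
Proof.
move=> mh h0 Eh s s0.
have mx2h : measurable_fun setT (fun x => x ^+ 2 * h x).
  by apply: measurable_funM => //; apply: measurable_funX.
have x2h0 x : 0 <= x ^+ 2 * h x by rewrite mulr_ge0 ?sqr_ge0.
pose c a := (1 - a ^+ 2) / (s ^+ 2 *+ 2).
pose e a x := expR ((1 - a ^+ 2) * x ^+ 2 / (s ^+ 2 *+ 2)).
have me a : measurable_fun setT (fun x => h x * e a x).
  apply: measurable_funM => //; apply: measurableT_comp => //.
  by apply: measurable_funM => //; apply: measurable_funM.
have s22 : 0 < s ^+ 2 *+ 2 by rewrite pmulrn_lgt0// exprn_gt0.
have Ee a : 0 < a -> (\int[normal_prob 0 s]_x (h x * e a x)%:E =
    (K * s ^+ p / a ^+ p.+1)%:E)%E.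
  move=> a0; rewrite ge0_integral_normal_tilt// Eh ?divr_gt0// -EFinM.
  by rewrite expr_div_n exprS invfM; congr EFin; ring.
have he a x : h x + c a * (x ^+ 2 * h x) <= h x * e a x.
  rewrite (_ : h x + _ = h x * (1 + (1 - a ^+ 2) * x ^+ 2 / (s ^+ 2 *+ 2))).
    by rewrite ler_wpM2l// expR_ge1Dx.
  by rewrite /c; ring.
pose I2 := (\int[normal_prob 0 s]_x (x ^+ 2 * h x)%:E)%E.
have I20 : (0 <= I2)%E by apply: integral_ge0 => x _; rewrite lee_fin.
have I2fin : I2 \is a fin_num.
  rewrite ge0_fin_numE//.
  have c0 : 0 < c 2^-1 by rewrite divr_gt0//; lra.
  have : ((c 2^-1)%:E * I2 < +oo)%E.
    rewrite -ge0_integralZl//; last 3 first.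
    - exact/measurable_EFinP.
    - by move=> x _; rewrite lee_fin.
    - by rewrite lee_fin ltW.
    apply: (@le_lt_trans _ _ (\int[normal_prob 0 s]_x (h x * e 2^-1 x)%:E)%E).
      apply: ge0_le_integral => //.
      - by move=> x _; rewrite -EFinM lee_fin mulr_ge0// ltW.
      - apply: emeasurable_funM => //; exact/measurable_EFinP.
      - by apply/measurable_EFinP; exact: me.
      - move=> x _; rewrite -EFinM lee_fin (le_trans _ (he _ _))//.
        by rewrite lerDr.
    by rewrite Ee ?invr_gt0// ltry.
  by case: I2 I20 => [r| |]//= _; rewrite ?ltry// gt0_muley ?lte_fin.
have int_h : (normal_prob 0 s).-integrable setT (EFin \o h).
  apply/integrableP; split; first exact/measurable_EFinP.
  by under eq_integral do rewrite /= ger0_norm//; rewrite Eh// ltry.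
have int_2 : (normal_prob 0 s).-integrable setT (fun x => (x ^+ 2 * h x)%:E).
  apply/integrableP; split; first exact/measurable_EFinP.
  by under eq_integral do rewrite /= ger0_norm//; rewrite -ge0_fin_numE.
have int_e a : 0 < a -> (normal_prob 0 s).-integrable setT
    (fun x => (h x * e a x)%:E).
  move=> a0; apply/integrableP; split; first by apply/measurable_EFinP; exact: me.
  under eq_integral do rewrite /= ger0_norm ?mulr_ge0 ?expR_ge0//.
  by rewrite Ee// ltry.
have int_c a : (normal_prob 0 s).-integrable setT
    (fun x => (c a * (x ^+ 2 * h x))%:E).
  by under eq_fun do rewrite EFinM; exact: integrableZl.
pose M := fine I2.
have key a : 0 < a -> K * s ^+ p + c a * M <= K * s ^+ p / a ^+ p.+1.
  move=> a0; rewrite -[leRHS]/(fine _%:E) -Ee//.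
  have -> : K * s ^+ p = \int[normal_prob 0 s]_x h x by rewrite /Rintegral Eh.
  rewrite /M /I2 -[fine _]/(\int[normal_prob 0 s]_x (x ^+ 2 * h x)).
  rewrite -RintegralZl// -RintegralD//; last exact: int_c.
  apply: le_Rintegral => //; last exact: int_e.
  rewrite (_ : EFin \o _ = (fun x => (h x)%:E + (c a * (x ^+ 2 * h x))%:E)%E);
    last by apply/funext => x.
  by apply: integrableD => //; exact: int_c.
(* B is the quotient by 1 - a of the difference of the two sides of key,
   multiplied by a^(p+1); it changes sign at 1 and so vanishes there. *)
pose B : {poly R} := (K * s ^+ p) *: \sum_(i < p.+1) 'X^i -
  (M / (s ^+ 2 *+ 2)) *: ('X^(p.+1) * (1 + 'X)).
have BE (a : R) : B.[a] = K * s ^+ p * (\sum_(i < p.+1) a ^+ i) -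
    (M / (s ^+ 2 *+ 2)) * (a ^+ p.+1 * (1 + a)).
  rewrite /B !hornerE horner_sum; congr (_ * _ - _).
  by apply: eq_bigr => i _; rewrite hornerXn.
have BG (a : R) : 0 < a -> 0 <= (1 - a) * B.[a].
  move=> a0; have := key a a0; rewrite ler_pdivlMr ?exprn_gt0// => H.
  have -> : (1 - a) * B.[a] = K * s ^+ p -
      (K * s ^+ p + c a * M) * a ^+ p.+1.
    rewrite BE mulrBr mulrCA.
    have -> : (1 - a) * (\sum_(i < p.+1) a ^+ i) = 1 - a ^+ p.+1.
      by rewrite -opprB mulNr -subrX1 opprB.
    by rewrite /c; field; rewrite ?gt_eqF.
  by rewrite subr_ge0.
have cB : {for 1, continuous (horner B)} by exact: continuous_horner.
have B1 : B.[1] = 0.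
  apply/eqP; rewrite eq_le; apply/andP; split.
  - have : B.[x] @[x --> (1 : R)^'+] --> B.[1] by exact: cvg_at_right_filter.
    move=> /cvgr_to_le; apply; near=> a.
    have a1 : 1 < a by near: a; exact: nbhs_right_gt.
    have /BG : 0 < a by rewrite (lt_trans _ a1).
    by rewrite nmulr_rge0// subr_lt0.
  - have : B.[x] @[x --> (1 : R)^'-] --> B.[1] by exact: cvg_at_left_filter.
    move=> /cvgr_to_ge; apply; near=> a.
    have a1 : a < 1 by near: a; exact: nbhs_left_lt.
    have /BG : 0 < a by near: a; exact: nbhs_left_gt.
    by rewrite pmulr_rge0// subr_gt0.
rewrite -/I2 -(fineK I2fin) -/M; congr EFin.
move: B1; rewrite BE expr1n mul1r.
under eq_bigr do rewrite expr1n.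
rewrite sumr_const card_ord => /eqP; rewrite subr_eq0 => /eqP B1.
rewrite (_ : M = M / (s ^+ 2 *+ 2) * (1 + 1) * s ^+ 2); last first.
  by field; rewrite gt_eqF.
by rewrite -B1 !exprS; ring.
Unshelve. all: end_near. Qed.

Lemma ge0_normal_integral_sqr1 s : 0 < s ->
  (\int[normal_prob 0 s]_x (x ^+ 2)%:E = (s ^+ 2)%:E)%E.
Proof.
move=> s0; have := @ge0_normal_integral_sqr (cst 1) 0 1 _ _ _ s s0.
rewrite (_ : _ * s ^+ 2 = s ^+ 2); last by rewrite mul1r mul1r.
move=> <-//.
- by apply: eq_integral => x _; rewrite mulr1.
- move=> t t0; rewrite -[X in X = _]/(\int[_]_(x in _) cst 1%E x)%E.
  by rewrite integral_cst// mul1e expr0 mulr1; exact: probability_setT.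
Qed.

Lemma ge0_normal_integral_X4 s : 0 < s ->
  (\int[normal_prob 0 s]_x (x ^+ 4)%:E = (3 * (s ^+ 2) ^+ 2)%:E)%E.
Proof.
move=> s0; have := @ge0_normal_integral_sqr (fun x => x ^+ 2) 2 1 _ _ _ s s0.
rewrite (_ : 3 * 1 * s ^+ 4 = 3 * (s ^+ 2) ^+ 2); last by ring.
move=> <-//.
- by apply: eq_integral => x _; rewrite -exprD.
- by move=> x; rewrite sqr_ge0.
- by move=> t t0; rewrite ge0_normal_integral_sqr1// mul1r.
Qed.

End normal_integrals.

Section normal_convolution.
Context {R : realType}.
Local Notation leb := (@lebesgue_measure R).
Implicit Types (a b c v w x y z : R).

(** Completing the square: given the sum [z], the first of two independent
    centred normal variables is again normal, with mean [z a^2 / c^2]. *)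
Lemma normal_pdf_mul a b c x z : 0 < a -> 0 < b -> 0 < c ->
  c ^+ 2 = a ^+ 2 + b ^+ 2 ->
  normal_pdf 0 a x * normal_pdf 0 b (z - x) =
  normal_pdf 0 c z * normal_pdf (z * a ^+ 2 / c ^+ 2) (a * b / c) x.
Proof.
move=> a0 b0 c0 cE.
have abc0 : 0 < a * b / c by rewrite divr_gt0// mulr_gt0.
rewrite !normal_pdfE ?gt_eqF// mulrACA [RHS]mulrACA; congr (_ * _).
  rewrite /normal_peak -!invfM -!sqrtrM ?mulrn_wge0 ?mulr_ge0 ?sqr_ge0 ?pi_ge0 ?ltW//.
  by congr (Num.sqrt _)^-1; field; rewrite gt_eqF.
rewrite /normal_fun -!expRD; congr expR.
have b2 : b ^+ 2 = c ^+ 2 - a ^+ 2 by rewrite cE addrC addKr.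
rewrite !exprMn exprVn b2.
have cab : c ^+ 2 - a ^+ 2 != 0 by rewrite -b2 gt_eqF// exprn_gt0.
by field; rewrite cab !gt_eqF.
Qed.

(** The expectation under N(0, v); the point mass has no density. *)
Definition normal_mean v (F : R -> \bar R) : \bar R :=
  if v == 0 then F 0 else
  (\int[leb]_x (F x * (normal_pdf 0 (Num.sqrt v) x)%:E))%E.

Lemma ge0_integral_normal_law d (T : measurableType d) (P : probability T R)
    (X : T -> R) v (F : R -> \bar R) :
  measurable_fun setT X ->
  (forall A, measurable A -> P (X @^-1` A) = normal_law0 v A) ->
  measurable_fun setT F -> (forall x, 0 <= F x)%E ->
  (\int[P]_w F (X w) = normal_mean v F)%E.
Proof.
move=> mX XE mF F0; rewrite /normal_mean; move: XE; rewrite /normal_law0.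
have id_meas : measurable_fun setT (@id R) by exact: measurable_id.
case: eqP => [v0 XE|v0 XE].
  rewrite (law_ge0_integral (m2 := dirac (0 : R)) mX id_meas XE)//.
  by rewrite integral_dirac// diracT mul1e.
rewrite (law_ge0_integral (m2 := normal_prob 0 (Num.sqrt v)) mX id_meas XE)//.
rewrite (ge0_integral_density (mu := leb) (g := normal_pdf 0 (Num.sqrt v)))//.
- exact: measurable_normal_pdf.
- by move=> x; exact: normal_pdf_ge0.
Qed.

Lemma ge0_integral_shift (G : R -> R) c : continuous G -> (forall x, 0 <= G x) ->
  (\int[leb]_y (G y)%:E = \int[leb]_y (G (y - c))%:E)%E.
Proof.
move=> cG G0.
have dF (x : R) : is_derive x 1 (fun y : R => y - c) 1.
  by rewrite -[X in is_derive _ _ _ X]subr0; apply: is_deriveB.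
have F'E : (fun y : R => y - c)^`()%classic = cst 1.
  by apply/funext => x; rewrite derive1E derive_val.
rewrite (@increasing_ge0_integration_by_substitutionT _ (fun y => y - c) G)//.
- by apply: eq_integral => x _; rewrite F'E /= mulr1.
- by move=> x y; rewrite ltrD2r.
- by rewrite F'E => x; exact: cvg_cst.
- by rewrite F'E; exact: is_cvg_cst.
- by rewrite F'E; exact: is_cvg_cst.
- exact: cvg_addrr_Ny.
- exact: cvg_addrr.
Qed.

(** Shift the inner variable to the sum [z], exchange the integrals and integrate
    out the first variable, whose conditional density has total mass 1. *)
Lemma normal_mean_conv v w (f : R -> R) : 0 <= v -> 0 <= w ->
  continuous f -> (forall x, 0 <= f x) ->
  normal_mean v (fun x => normal_mean w (fun y => (f (x + y))%:E)) =
  normal_mean (v + w) (EFin \o f).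
Proof.
move=> v0 w0 cf f0; rewrite /normal_mean paddr_eq0//.
have [->|vn0] := eqVneq v 0.
  rewrite !add0r; case: ifP => _ //.
  by apply: eq_integral => y _; rewrite /= add0r.
have [->|wn0] := eqVneq w 0.
  by rewrite addr0 /=; apply: eq_integral => x _; rewrite addr0.
have vp : 0 < v by rewrite lt_def vn0.
have wp : 0 < w by rewrite lt_def wn0.
rewrite /=.
set a := Num.sqrt v; set b := Num.sqrt w; set c := Num.sqrt (v + w).
have a0 : 0 < a by rewrite sqrtr_gt0.
have b0 : 0 < b by rewrite sqrtr_gt0.
have c0 : 0 < c by rewrite sqrtr_gt0 addr_gt0.
have cE : c ^+ 2 = a ^+ 2 + b ^+ 2 by rewrite !sqr_sqrtr// addr_ge0.
have mf : measurable_fun setT f by exact: continuous_measurable_fun.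
transitivity (\int[leb]_x \int[leb]_z
    (f z * (normal_pdf 0 a x * normal_pdf 0 b (z - x)))%:E)%E.
  apply: eq_integral => x _; rewrite muleC.
  transitivity (\int[leb]_y ((normal_pdf 0 a x)%:E *
      ((f (x + y))%:E * (normal_pdf 0 b y)%:E)))%E.
    rewrite [RHS]ge0_integralZl//.
    - apply: emeasurable_funM; apply/measurable_EFinP.
        by apply: measurableT_comp => //; exact: measurable_funD.
      exact: measurable_normal_pdf.
    - by move=> y _; rewrite -EFinM lee_fin mulr_ge0// normal_pdf_ge0.
    - by rewrite lee_fin normal_pdf_ge0.
  transitivity (\int[leb]_y (normal_pdf 0 a x * (f (x + y) * normal_pdf 0 b y))%:E)%E.
    by apply: eq_integral => y _; rewrite !EFinM.
  rewrite (@ge0_integral_shift _ x).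
  - by apply: eq_integral => z _; rewrite mulrCA addrC subrK.
  - move=> y; apply: cvgM; first exact: cvg_cst.
    apply: cvgM; last by apply: continuous_normal_pdf; rewrite gt_eqF.
    apply: (@continuous_comp _ _ _ (fun y => x + y) f); last exact: cf.
    by apply: cvgD; [exact: cvg_cst|exact: cvg_id].
  - by move=> y; rewrite !mulr_ge0// normal_pdf_ge0.
transitivity (\int[leb]_z \int[leb]_x
    (f z * (normal_pdf 0 a x * normal_pdf 0 b (z - x)))%:E)%E.
  apply: (fubini_tonelli (m1 := leb) (m2 := leb) (fun xz : R * R =>
    (f xz.2 * (normal_pdf 0 a xz.1 * normal_pdf 0 b (xz.2 - xz.1)))%:E)).
  - apply/measurable_EFinP; apply: measurable_funM.
      exact: measurableT_comp.
    apply: measurable_funM.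
      by apply: measurableT_comp; [exact: measurable_normal_pdf|].
    apply: measurableT_comp; first exact: measurable_normal_pdf.
    exact: measurable_funB.
  - by move=> xz; rewrite lee_fin !mulr_ge0// normal_pdf_ge0.
apply: eq_integral => z _.
under eq_integral do rewrite (normal_pdf_mul _ _ a0 b0 c0 cE) mulrA EFinM.
rewrite ge0_integralZl//.
- by rewrite integral_normal_pdf mule1 EFinM.
- by apply/measurable_EFinP; exact: measurable_normal_pdf.
- by move=> x _; rewrite lee_fin normal_pdf_ge0.
- by rewrite lee_fin mulr_ge0// normal_pdf_ge0.
Qed.

End normal_convolution.

(** * Independence, conditioning and Gaussian vectors *)

Section conditioning.
Context {R : realType}.

Definition cond d (T : measurableType d) (P : probability T R) (B : set T)
  (mB : measurable B) : probability T R := mnormalize (mrestr P mB) P.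

Lemma condE d (T : measurableType d) (P : probability T R) (B : set T)
    (mB : measurable B) A : P B != 0%E -> cond P mB A = cond_prob P A B.
Proof.
move=> PB0; rewrite /cond /=.
have E : (mrestr P mB : {measure set T -> \bar R}) setT = P B.
  by rewrite /= /mrestr setTI.
rewrite /mnormalize E (negbTE PB0)/= lt_eqF//.
exact: le_lt_trans (probability_le1 P mB) (ltry _).
Qed.

(** Conditioning on a null event gives the zero measure, which is not a law. *)
Lemma same_law_cond_neq0 d1 (T1 : measurableType d1) (P1 : probability T1 R)
    d2 (T2 : measurableType d2) (P2 : probability T2 R) n
    (X1 : T1 -> 'cV[R]_n) (X2 : T2 -> 'cV[R]_n) (B : set T2) :
  same_law_cond P1 P2 X1 X2 B -> P2 B != 0%E.
Proof.
move=> /(_ setT measurableT); rewrite preimage_setT probability_setT.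
rewrite /cond_prob => H; apply/eqP => PB0; move: H.
rewrite PB0 /= invr0 mule0 => /eqP.
by rewrite onee_eq0.
Qed.

(** Both sides are measures in [A], so it suffices to compare them on
    rectangles. *)
Lemma cond_product d1 (T1 : measurableType d1) (P1 : probability T1 R)
    d2 (T2 : measurableType d2) (P2 : probability T2 R)
    (B : set T1) (mB : measurable B) A :
  measurable A -> P1 B != 0%E ->
  cond_prob (P1 \x P2)%E A (B `*` setT) = (cond P1 mB \x P2)%E A.
Proof.
move=> mA PB0.
have mBT : measurable (B `*` [set: T2]) by exact: measurableX.
pose P12 : probability (T1 * T2)%type R := (P1 \x P2)%E.
have PBT : P12 (B `*` setT) = P1 B.
  rewrite [LHS]product_measure1E// -[RHS]mule1; congr (_ * _)%E.
  exact: probability_setT.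
have PBT0 : P12 (B `*` setT) != 0%E by rewrite PBT.
rewrite -[LHS](condE (P := P12) mBT)//; apply/esym.
apply: product_measure_unique => // A1 A2 mA1 mA2.
transitivity (cond_prob P12 (A1 `*` A2) (B `*` setT)); first exact: condE.
rewrite /cond_prob PBT -setXI setIT [P12 _]product_measure1E//; last first.
  exact: measurableI.
rewrite -[LHS]muleA [X in (_ * X)%E]muleC muleA; congr (_ * _)%E.
by apply/esym; exact: condE.
Qed.

(** Independence says that the joint law agrees with the product of the marginal
    laws on rectangles, hence everywhere. *)
Lemma independent_pair_law d1 (T1 : measurableType d1) (P1 : probability T1 R)
    d2 (T2 : measurableType d2) (P2 : probability T2 R)
    d3 (T3 : measurableType d3) (P3 : probability T3 R) m n
    (X : T1 -> 'cV[R]_m) (Y : T1 -> 'cV[R]_n)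
    (X' : T2 -> 'cV[R]_m) (Y' : T3 -> 'cV[R]_n) :
  measurable_fun setT X -> measurable_fun setT Y ->
  measurable_fun setT X' -> measurable_fun setT Y' ->
  independent_rv P1 X Y -> same_law P1 P2 X X' -> same_law P1 P3 Y Y' ->
  forall E, measurable E ->
    P1 ((fun w => (X w, Y w)) @^-1` E) =
    (P2 \x P3)%E ((fun z => (X' z.1, Y' z.2)) @^-1` E).
Proof.
move=> mX mY mX' mY' indXY XX' YY' E mE.
pose pX := mfun_Sub (mem_set mX : X \in mfun).
pose pY := mfun_Sub (mem_set mY : Y \in mfun).
have mXY : measurable_fun setT (fun w => (X w, Y w)).
  exact: measurable_fun_pair.
have mXY' : measurable_fun setT (fun z : T2 * T3 => (X' z.1, Y' z.2)).
  by apply: measurable_fun_pair; exact: measurableT_comp.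
pose pXY := mfun_Sub (mem_set mXY : _ \in mfun).
pose pXY' := mfun_Sub (mem_set mXY' : _ \in mfun).
transitivity ((distribution P1 pX \x distribution P1 pY)%E E).
  apply/esym; apply: (product_measure_unique (m1 := distribution P1 pX)
    (m2 := distribution P1 pY) (m' := distribution P1 pXY)) => //.
apply: (product_measure_unique (m1 := distribution P1 pX)
  (m2 := distribution P1 pY) (m' := distribution (P2 \x P3)%E pXY')) => //.
move=> A B mA mB.
transitivity ((P2 \x P3)%E ((X' @^-1` A) `*` (Y' @^-1` B))); first by [].
rewrite product_measure1E//.
- by congr (_ * _)%E; apply/esym; [exact: XX'|exact: YY'].
- by rewrite -[_ @^-1` _]setTI; exact: mX'.
- by rewrite -[_ @^-1` _]setTI; exact: mY'.
Qed.

End conditioning.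

Section gaussian_vectors.
Context {R : realType}.

Lemma measurable_dot d (T : measurableType d) n (t : 'cV[R]_n)
    (X : T -> 'cV[R]_n) : measurable_fun setT X ->
  measurable_fun setT (fun w => (t^T *m X w) 0 0).
Proof.
move=> mX; apply: (measurableT_comp (measurable_mx_entry ord0 ord0)).
exact: measurable_mulmxl.
Qed.

Lemma measurable_cosD d (T : measurableType d) (X : T -> R) a :
  measurable_fun setT X -> measurable_fun setT (fun w => cos (X w + a)).
Proof.
move=> mX; apply: measurableT_comp.
  by apply: continuous_measurable_fun; exact: continuous_cos.
exact: measurable_funD.
Qed.

(** Adding 1 makes the cosine nonnegative, as needed for Tonelli's theorem and
    for integration against densities. *)
Lemma Rintegral_cosE d (T : measurableType d) (P : probability T R)
    (X : T -> R) a : measurable_fun setT X ->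
  \int[P]_w cos (X w + a) = fine (\int[P]_w (1 + cos (X w + a))%:E)%E - 1.
Proof.
move=> mX; rewrite -[fine _]/(\int[P]_w (1 + cos (X w + a))).
have int1 : P.-integrable setT (EFin \o cst (1 : R)).
  exact: finite_measure_integrable_cst.
rewrite RintegralD//; first 1 last.
  apply: (@le_integrable _ _ _ _ setT measurableT _ (EFin \o cst (1 : R))) => //.
    by apply/measurable_EFinP; exact: measurable_cosD.
  by move=> w _; rewrite /= lee_fin normr1 cos_max.
rewrite Rintegral_cst// mul1r (_ : fine _ = 1); last first.
  exact: (congr1 fine (probability_setT P)).
by rewrite [1 + _]addrC addrK.
Qed.

Lemma Rintegral_cos_normalD d1 (T1 : measurableType d1) (P1 : probability T1 R)
    d2 (T2 : measurableType d2) (P2 : probability T2 R)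
    d3 (T3 : measurableType d3) (P3 : probability T3 R)
    (X : T1 -> R) (Y : T2 -> R) (Z : T3 -> R) v w a :
  measurable_fun setT X -> measurable_fun setT Y -> measurable_fun setT Z ->
  0 <= v -> 0 <= w ->
  (forall A, measurable A -> P1 (X @^-1` A) = normal_law0 v A) ->
  (forall A, measurable A -> P2 (Y @^-1` A) = normal_law0 w A) ->
  (forall A, measurable A -> P3 (Z @^-1` A) = normal_law0 (v + w) A) ->
  \int[P3]_s cos (Z s + a) = \int[(P1 \x P2)%E]_s cos (X s.1 + Y s.2 + a).
Proof.
move=> mX mY mZ v0 w0 EX EY EZ.
pose k (z : R) := 1 + cos (z + a).
have k0 z : 0 <= k z.
  by rewrite /k -lerBlDl sub0r; have := cos_max (z + a); rewrite ler_norml => /andP[].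
have ck : continuous k.
  move=> z; apply: cvgD; first exact: cvg_cst.
  apply: (@continuous_comp _ _ _ (fun z => z + a) cos); last exact: continuous_cos.
  by apply: cvgD; [exact: cvg_id|exact: cvg_cst].
have mk : measurable_fun setT k by exact: continuous_measurable_fun.
have mXY : measurable_fun setT (fun s : T1 * T2 => X s.1 + Y s.2).
  by apply: measurable_funD; exact: measurableT_comp.
rewrite !Rintegral_cosE//; congr (fine _ - 1).
rewrite -[LHS]/(\int[P3]_s (EFin \o k) (Z s))%E.
rewrite (ge0_integral_normal_law mZ EZ)//; last first.
  by apply/measurable_EFinP.
rewrite -normal_mean_conv//.
rewrite -[RHS]/(\int[(P1 \x P2)%E]_s (k (X s.1 + Y s.2))%:E)%E.
rewrite fubini_tonelli1//=; first last.
- by move=> s; rewrite lee_fin.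
- by apply/measurable_EFinP; exact: measurableT_comp.
have mkx (x : R) : measurable_fun setT (fun y => (k (x + y))%:E).
  apply/measurable_EFinP; apply: measurableT_comp => //.
  exact: measurable_funD.
pose Fw (x : R) := normal_mean w (fun y => (k (x + y))%:E).
have Fw0 x : (0 <= Fw x)%E.
  rewrite /Fw /normal_mean; case: eqP => _; first by rewrite lee_fin.
  by apply: integral_ge0 => y _; rewrite -EFinM lee_fin mulr_ge0// normal_pdf_ge0.
have mFw : measurable_fun setT Fw.
  rewrite /Fw /normal_mean; case: eqP => _.
    apply/measurable_EFinP; apply: measurableT_comp => //.
    exact: measurable_funD.
  apply: (measurable_fun_fubini_tonelli_F (m2 := @lebesgue_measure R)
    (fun xy : R * R => (k (xy.1 + xy.2))%:E *
                       (normal_pdf 0 (Num.sqrt w) xy.2)%:E)%E).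
  - apply: emeasurable_funM; apply/measurable_EFinP; apply: measurableT_comp => //.
      exact: measurable_funD.
    exact: measurable_normal_pdf.
  - by move=> xy; rewrite -EFinM lee_fin mulr_ge0// normal_pdf_ge0.
transitivity (\int[P1]_s Fw (X s))%E.
  by apply/esym; exact: (ge0_integral_normal_law mX EX mFw Fw0).
apply: eq_integral => s _; apply/esym.
apply: (ge0_integral_normal_law (F := fun y => (k (X s + y))%:E) mY EY) => //.
by move=> y; rewrite lee_fin.
Qed.

Lemma mvnormal0_mulmx d (T : measurableType d) (P : probability T R) n p
    (X : T -> 'cV[R]_n) (S : 'M[R]_n) (A : 'M[R]_(p, n)) :
  mvnormal0 P X S -> mvnormal0 P (fun w => A *m X w) (A *m S *m A^T).
Proof.
move=> NX t B mB.
have := NX (A^T *m t) B mB; rewrite trmx_mul trmxK !mulmxA => <-.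
by congr (P _); apply/funext => w /=; rewrite mulmxA.
Qed.

Lemma dot_col_mx p q (t : 'cV[R]_(p + q)) (x : 'cV[R]_p) (y : 'cV[R]_q) :
  (t^T *m col_mx x y) 0 0 =
  ((usubmx t)^T *m x) 0 0 + ((dsubmx t)^T *m y) 0 0.
Proof. by rewrite -{1}(vsubmxK t) tr_col_mx mul_row_col mxE. Qed.

(** Every linear form of either vector is centred normal, on the right as a sum
    of independent forms in [W] and [H]; the two hypotheses on [A] and [D] say
    that the variances agree. *)
Lemma same_law_regression d0 (T0 : measurableType d0) (P0 : probability T0 R)
    d1 (T1 : measurableType d1) (P1 : probability T1 R)
    d2 (T2 : measurableType d2) (P2 : probability T2 R) p q
    (X0 : T0 -> 'cV[R]_p) (X1 : T0 -> 'cV[R]_q)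
    (W : T1 -> 'cV[R]_q) (H : T2 -> 'cV[R]_p)
    (A : 'M[R]_p) (D : 'M[R]_(p, q)) (G : 'M[R]_q)
    (L : 'M[R]_(p, q)) (Psi : 'M[R]_p) :
  measurable_fun setT X0 -> measurable_fun setT X1 ->
  measurable_fun setT W -> measurable_fun setT H ->
  mvnormal0 P0 (fun w => col_mx (X0 w) (X1 w)) (block_mx A D D^T G) ->
  mvnormal0 P1 W G -> mvnormal0 P2 H Psi ->
  psdmx G -> psdmx Psi ->
  A = L *m G *m L^T + Psi -> D = L *m G ->
  same_law P0 (P1 \x P2)%E (fun w => col_mx (X0 w) (X1 w))
    (fun z => col_mx (L *m W z.1 + H z.2) (W z.1)).
Proof.
move=> mX0 mX1 mW mH NX NW NH [GT G0] [_ Psi0] AE DE.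
have mW1 : measurable_fun setT (fun z : T1 * T2 => W z.1).
  exact: measurableT_comp.
have mH2 : measurable_fun setT (fun z : T1 * T2 => H z.2).
  exact: measurableT_comp.
apply: same_law_wave.
- exact: measurable_col_mx.
- apply: measurable_col_mx => //; apply: measurable_addmx => //.
  exact: measurable_mulmxl.
move=> t a; set s := usubmx t; set r := dsubmx t.
have Ls : (L^T *m s + r)^T = s^T *m L + r^T.
  by rewrite linearD/= trmx_mul trmxK.
transitivity (\int[(P1 \x P2)%E]_z
    cos ((((L^T *m s + r)^T *m W z.1) 0 0 + (s^T *m H z.2) 0 0) + a)).
  apply: (Rintegral_cos_normalD
    (X := fun w => ((L^T *m s + r)^T *m W w) 0 0)
    (Y := fun w => (s^T *m H w) 0 0)
    (v := (((L^T *m s + r)^T *m G *m (L^T *m s + r)) 0 0))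
    (w := ((s^T *m Psi *m s) 0 0))).
  - exact: measurable_dot.
  - exact: measurable_dot.
  - by apply: measurable_dot; exact: measurable_col_mx.
  - exact: G0.
  - exact: Psi0.
  - by move=> B mB; exact: NW.
  - by move=> B mB; exact: NH.
  - move=> B mB; apply: etrans (NX t B mB) _; congr (normal_law0 _ B).
    rewrite -{1 2}(vsubmxK t) -/s -/r tr_col_mx mul_row_block mul_row_col.
    rewrite AE DE trmx_mul GT Ls.
    rewrite !(mulmxDl, mulmxDr) !mulmxA !mxE.
    by ring.
apply: eq_Rintegral => z _; congr (cos (_ + a)).
rewrite dot_col_mx -/s -/r mulmxDr Ls !mulmxDl !mulmxA.
by rewrite !mxE; ring.
Qed.

End gaussian_vectors.

(** * Moments of order at most four *)

Section fourth_moments.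
Context {R : realType} d (T : measurableType d) (P : probability T R).
Implicit Types f g : T -> R.

(** Functions with a finite fourth moment form a vector space, and a product of
    at most four of them is integrable. *)
Definition L4 f := measurable_fun setT f /\
  P.-integrable setT (fun w => (f w ^+ 4)%:E).

Local Notation integ f := (P.-integrable setT (fun w => (f w)%:E)).

Lemma integrable_le f g : measurable_fun setT f ->
  (forall w, `|f w| <= g w) -> integ g -> integ f.
Proof.
move=> mf fg ig; apply: (le_integrable measurableT _ _ ig).
  exact/measurable_EFinP.
by move=> w _; rewrite /= lee_fin (le_trans (fg w))// ler_norm.
Qed.

Lemma integrable_add f g : integ f -> integ g -> integ (fun w => f w + g w).
Proof.
by move=> fi gi; under eq_fun do rewrite EFinD; exact: integrableD.
Qed.

Lemma integrable_scale c f : integ f -> integ (fun w => c * f w).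
Proof.
by move=> fi; under eq_fun do rewrite EFinM; exact: integrableZl.
Qed.

Lemma integrable_const c : integ (fun=> c).
Proof. exact: finite_measure_integrable_cst. Qed.

Lemma integrable_bigsum (I : finType) (F : I -> T -> R) :
  (forall i, integ (F i)) -> integ (fun w => \sum_i F i w).
Proof.
move=> Fi; elim: (index_enum I) => [|i s IH].
  by under eq_fun do rewrite big_nil; exact: integrable_const.
by under eq_fun do rewrite big_cons; exact: integrable_add.
Qed.

Lemma Rintegral_bigsum (I : finType) (F : I -> T -> R) :
  (forall i, integ (F i)) ->
  \int[P]_w (\sum_i F i w) = \sum_i \int[P]_w F i w.
Proof.
move=> Fi; elim: (index_enum I) => [|i s IH].
  by rewrite big_nil; under eq_Rintegral do rewrite big_nil;
    rewrite Rintegral_cst// mul0r.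
have sint : integ (fun w => \sum_(j <- s) F j w).
  elim: s {IH} => [|j s IH].
    by under eq_fun do rewrite big_nil; exact: integrable_const.
  by under eq_fun do rewrite big_cons; exact: integrable_add.
rewrite big_cons -IH -RintegralD//; last exact: Fi.
by apply: eq_Rintegral => w _; rewrite big_cons.
Qed.

Lemma Rintegral_const c : \int[P]_w c = c.
Proof.
rewrite Rintegral_cst// (_ : fine _ = 1) ?mulr1//.
exact: (congr1 fine (probability_setT P)).
Qed.

Lemma L4_cst c : L4 (fun=> c).
Proof. by split=> //; exact: integrable_const. Qed.

Lemma L4Z c f : L4 f -> L4 (fun w => c * f w).
Proof.
move=> [mf fi]; split; first exact: measurable_funM.
by under eq_fun do rewrite exprMn; exact: integrable_scale.
Qed.

Lemma L4D f g : L4 f -> L4 g -> L4 (fun w => f w + g w).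
Proof.
move=> [mf fi] [mg gi].
have mfg : measurable_fun setT (fun w => f w + g w) by exact: measurable_funD.
split=> //.
apply: (@integrable_le _ (fun w => 8 * (f w ^+ 4 + g w ^+ 4))).
- exact: measurable_funX.
- move=> w; rewrite ger0_norm; last first.
    by rewrite (_ : 4 = 2 * 2)%N// exprM sqr_ge0.
  move: (f w) (g w) => x y.
  rewrite -subr_ge0 (_ : _ - _ =
    (x - y) ^+ 2 * (5 * (x + y) ^+ 2 + 2 * x ^+ 2 + 2 * y ^+ 2)); last by ring.
  by rewrite mulr_ge0 ?sqr_ge0// !addr_ge0// mulr_ge0// sqr_ge0.
- exact/integrable_scale/integrable_add.
Qed.

Lemma L4_bigsum (I : finType) (F : I -> T -> R) :
  (forall i, L4 (F i)) -> L4 (fun w => \sum_i F i w).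
Proof.
move=> Fi; elim: (index_enum I) => [|i s IH].
  by under eq_fun do rewrite big_nil; exact: L4_cst.
by under eq_fun do rewrite big_cons; exact: L4D.
Qed.

Lemma L4_integrable4 f1 f2 f3 f4 : L4 f1 -> L4 f2 -> L4 f3 -> L4 f4 ->
  integ (fun w => f1 w * f2 w * f3 w * f4 w).
Proof.
move=> [m1 i1] [m2 i2] [m3 i3] [m4 i4].
apply: (@integrable_le _ (fun w => f1 w ^+ 4 + f2 w ^+ 4 + f3 w ^+ 4 + f4 w ^+ 4)).
- by do 3 apply: measurable_funM => //.
- have E x : x ^+ 4 = `|x : R| ^+ 4.
    by rewrite -normrX ger0_norm// (_ : 4 = 2 * 2)%N// exprM sqr_ge0.
  move=> w; rewrite !normrM (E (f1 w)) (E (f2 w)) (E (f3 w)) (E (f4 w)).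
  move: `|f1 w| `|f2 w| `|f3 w| `|f4 w| (normr_ge0 (f1 w)) (normr_ge0 (f2 w))
    (normr_ge0 (f3 w)) (normr_ge0 (f4 w)) => x y z t x0 y0 z0 t0.
  have H1 : x * y * z * t <= (x * y) ^+ 2 + (z * t) ^+ 2.
    rewrite -subr_ge0 (_ : _ - _ =
      2^-1 * ((x * y - z * t) ^+ 2 + (x * y) ^+ 2 + (z * t) ^+ 2)); last by field.
    by rewrite mulr_ge0// !addr_ge0// sqr_ge0.
  have H2 (u v : R) : (u * v) ^+ 2 <= u ^+ 4 + v ^+ 4.
    rewrite -subr_ge0 (_ : _ - _ =
      2^-1 * ((u ^+ 2 - v ^+ 2) ^+ 2 + (u ^+ 2) ^+ 2 + (v ^+ 2) ^+ 2));
      last by field.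
    by rewrite mulr_ge0// !addr_ge0// sqr_ge0.
  by rewrite (le_trans H1)// -addrA lerD.
- by do 3 apply: integrable_add => //.
Qed.

Lemma L4_integrable3 f1 f2 f3 : L4 f1 -> L4 f2 -> L4 f3 ->
  integ (fun w => f1 w * f2 w * f3 w).
Proof.
move=> l1 l2 l3; under eq_fun do rewrite -[_ * _]mulr1.
by apply: L4_integrable4 => //; exact: L4_cst.
Qed.

Lemma L4_integrable2 f1 f2 : L4 f1 -> L4 f2 -> integ (fun w => f1 w * f2 w).
Proof.
move=> l1 l2; under eq_fun do rewrite -[_ * _]mulr1.
by apply: L4_integrable3 => //; exact: L4_cst.
Qed.

Lemma L4_integrable1 f : L4 f -> integ f.
Proof.
move=> l; under eq_fun do rewrite -[f _]mulr1.
by apply: L4_integrable2 => //; exact: L4_cst.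
Qed.

End fourth_moments.

Section product_integrals.
Context {R : realType} d1 (T1 : measurableType d1) (P1 : probability T1 R)
  d2 (T2 : measurableType d2) (P2 : probability T2 R).
Local Notation Q := (P1 \x P2)%E.

Lemma integrable_prodM (f : T1 -> R) (g : T2 -> R) :
  P1.-integrable setT (EFin \o f) -> P2.-integrable setT (EFin \o g) ->
  Q.-integrable setT (fun z => (f z.1 * g z.2)%:E).
Proof.
move=> fi gi.
have /measurable_EFinP mf := measurable_int P1 fi.
have /measurable_EFinP mg := measurable_int P2 gi.
apply/integrable12ltyP.
  by apply/measurable_EFinP; apply: measurable_funM; exact: measurableT_comp.
under eq_integral.
  move=> x _; rewrite /=.
  under eq_integral do rewrite normrM EFinM.
  rewrite ge0_integralZl//; last first.
    by apply/measurable_EFinP; exact: measurableT_comp.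
  rewrite muleC.
  over.
have /integrableP[_ fi'] := fi; have /integrableP[_ gi'] := gi.
rewrite /= ge0_integralZl//.
- apply: lte_mul_pinfty => //; first exact: integral_ge0.
  by rewrite ge0_fin_numE//; exact: integral_ge0.
- by apply/measurable_EFinP; exact: measurableT_comp.
- exact: integral_ge0.
Qed.

Lemma Rintegral_prodM (f : T1 -> R) (g : T2 -> R) :
  P1.-integrable setT (EFin \o f) -> P2.-integrable setT (EFin \o g) ->
  \int[Q]_z (f z.1 * g z.2) = (\int[P1]_w f w) * (\int[P2]_w g w).
Proof.
move=> fi gi.
have fgi := integrable_prodM fi gi.
have gfin : (\int[P2]_y (g y)%:E)%E = (\int[P2]_w g w)%:E.
  by rewrite fineK//; exact: integrable_fin_num gi.
have ffin : (\int[P1]_x (f x)%:E)%E = (\int[P1]_w f w)%:E.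
  by rewrite fineK//; exact: integrable_fin_num fi.
rewrite /Rintegral -(integral12_prod_meas1 fgi) -/(Rintegral _ _ _).
rewrite -[RHS]/(fine (\int[P1]_w f w * \int[P2]_w g w)%:E); congr fine.
rewrite EFinM -ffin -integralZr//.
apply: eq_integral => x _; rewrite -gfin -integralZl//.
Qed.

End product_integrals.

Section gaussian_moments.
Context {R : realType} d (T : measurableType d) (P : probability T R) (n : nat).
Variables (X : T -> 'cV[R]_n) (S : 'M[R]_n).
Hypotheses (mX : measurable_fun setT X) (psdS : psdmx S) (NX : mvnormal0 P X S).

Definition dotX (t : 'cV[R]_n) w : R := (t^T *m X w) 0 0.
Definition covX (s t : 'cV[R]_n) : R := (s^T *m S *m t) 0 0.

Lemma dotXD s t w : dotX (s + t) w = dotX s w + dotX t w.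
Proof. by rewrite /dotX linearD/= mulmxDl mxE. Qed.

Lemma dotXZ a t w : dotX (a *: t) w = a * dotX t w.
Proof. by rewrite /dotX linearZ/= -scalemxAl mxE. Qed.

Lemma covXDl s t u : covX (s + t) u = covX s u + covX t u.
Proof. by rewrite /covX linearD/= !mulmxDl mxE. Qed.

Lemma covXDr s t u : covX u (s + t) = covX u s + covX u t.
Proof. by rewrite /covX mulmxDr mxE. Qed.

Lemma covXZl a s t : covX (a *: s) t = a * covX s t.
Proof. by rewrite /covX linearZ/= -!scalemxAl mxE. Qed.

Lemma covXZr a s t : covX s (a *: t) = a * covX s t.
Proof. by rewrite /covX -scalemxAr mxE. Qed.

Lemma measurable_dotX t : measurable_fun setT (dotX t).
Proof. exact: measurable_dot. Qed.

Lemma ge0_integral_dotX_sqr t :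
  (\int[P]_w (dotX t w ^+ 2)%:E = (covX t t)%:E)%E.
Proof.
have mF : measurable_fun setT (fun x : R => (x ^+ 2)%:E).
  by apply/measurable_EFinP; exact: measurable_funX.
have F0 (x : R) : (0 <= (x ^+ 2)%:E)%E by rewrite lee_fin sqr_ge0.
rewrite (ge0_integral_normal_law (measurable_dotX t) (NX t) mF F0).
rewrite /normal_mean -/(covX t t); case: eqP => [->|/eqP c0].
  by rewrite expr0n.
have cp : 0 < covX t t by rewrite lt_def c0; exact: psdS.2.
under eq_integral do rewrite -EFinM.
rewrite -ge0_integral_normal//.
by rewrite ge0_normal_integral_sqr1 ?sqrtr_gt0// sqr_sqrtr// ltW.
Qed.

Lemma ge0_integral_dotX_X4 t :
  (\int[P]_w (dotX t w ^+ 4)%:E = (3 * covX t t ^+ 2)%:E)%E.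
Proof.
have mF : measurable_fun setT (fun x : R => (x ^+ 4)%:E).
  by apply/measurable_EFinP; exact: measurable_funX.
have x40 (x : R) : 0 <= x ^+ 4 by rewrite (_ : 4 = 2 * 2)%N// exprM sqr_ge0.
have F0 (x : R) : (0 <= (x ^+ 4)%:E)%E by rewrite lee_fin.
rewrite (ge0_integral_normal_law (measurable_dotX t) (NX t) mF F0).
rewrite /normal_mean -/(covX t t); case: eqP => [->|/eqP c0].
  by rewrite !expr0n mulr0.
have cp : 0 < covX t t by rewrite lt_def c0; exact: psdS.2.
under eq_integral do rewrite -EFinM.
rewrite -ge0_integral_normal//.
by rewrite ge0_normal_integral_X4 ?sqrtr_gt0// sqr_sqrtr// ltW.
Qed.

Lemma L4_dotX t : L4 P (dotX t).
Proof.
split; first exact: measurable_dotX.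
apply/integrableP; split.
  by apply/measurable_EFinP; apply: measurable_funX; exact: measurable_dotX.
under eq_integral.
  move=> w _; rewrite /= ger0_norm; last first.
    by rewrite (_ : 4 = 2 * 2)%N// exprM sqr_ge0.
  over.
by rewrite ge0_integral_dotX_X4 ltry.
Qed.

Lemma Rintegral_dotX_sqr t : \int[P]_w (dotX t w ^+ 2) = covX t t.
Proof. by rewrite /Rintegral ge0_integral_dotX_sqr. Qed.

Lemma Rintegral_dotX_X4 t : \int[P]_w (dotX t w ^+ 4) = 3 * covX t t ^+ 2.
Proof. by rewrite /Rintegral ge0_integral_dotX_X4. Qed.

(** The forms [dotX t] and [dotX (- t)] are opposite and have the same
    variance, hence the same law. *)
Lemma Rintegral_dotX_odd (f : R -> R) t : measurable_fun setT f ->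
  (forall x, f (- x) = - f x) ->
  P.-integrable setT (fun w => (f (dotX t w))%:E) ->
  \int[P]_w f (dotX t w) = 0.
Proof.
move=> mf fN fi.
have H : \int[P]_w f (dotX t w) = \int[P]_w f (dotX (- t) w).
  have E A : measurable A -> P (dotX t @^-1` A) = P (dotX (- t) @^-1` A).
    move=> mA; have H1 := NX t mA; have H2 := NX (- t) mA.
    rewrite linearN/= !mulNmx mulmxN opprK in H2.
    by rewrite [LHS]H1 -H2; congr (P (_ @^-1` A)); apply/funext => w;
      rewrite /dotX linearN.
  exact: (law_Rintegral (measurable_dotX t) (measurable_dotX (- t)) E mf).
have H2 : \int[P]_w f (dotX (- t) w) = - \int[P]_w f (dotX t w).
  rewrite -mulN1r -RintegralZl//; apply: eq_Rintegral => w _.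
  by rewrite -scaleN1r dotXZ mulN1r fN mulN1r.
by move: H H2; set I := \int[P]_w f (dotX t w); lra.
Qed.

Lemma Rintegral_dotX1 t : \int[P]_w dotX t w = 0.
Proof.
apply: (@Rintegral_dotX_odd id) => //.
by apply: L4_integrable1; exact: L4_dotX.
Qed.

Lemma Rintegral_dotX_cube t : \int[P]_w (dotX t w ^+ 3) = 0.
Proof.
apply: (@Rintegral_dotX_odd (fun x => x ^+ 3)) => //.
- by move=> x; rewrite exprNn -signr_odd/= expr1 mulN1r.
- under eq_fun do rewrite !exprS expr0 mulr1 mulrA.
  by apply: L4_integrable3; exact: L4_dotX.
Qed.

Local Notation e b := ((-1) ^+ (nat_of_bool b) : R).

Lemma covXC s t : covX s t = covX t s.
Proof.
rewrite /covX; have -> : s^T *m S *m t = (t^T *m S *m s)^T.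
  by rewrite !trmx_mul trmxK psdS.1 mulmxA.
by rewrite [LHS]mxE.
Qed.

(** The three lemmas below polarize the one-dimensional moments: a product of
    linear forms is a signed sum of powers of the forms with signed summands. *)
Lemma Rintegral_dotX2 s t : \int[P]_w (dotX s w * dotX t w) = covX s t.
Proof.
transitivity (\int[P]_w (\sum_(b : bool)
    e b / 4 * (dotX (s + e b *: t) w ^+ 2))).
  apply: eq_Rintegral => w _; rewrite big_bool/= !dotXD !dotXZ expr0 expr1.
  by field.
rewrite Rintegral_bigsum; last first.
  move=> b; apply: integrable_scale; under eq_fun do rewrite expr2.
  by apply: L4_integrable2; exact: L4_dotX.
have E (b : bool) : \int[P]_w (e b / 4 * (dotX (s + e b *: t) w ^+ 2)) =
    e b / 4 * covX (s + e b *: t) (s + e b *: t).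
  rewrite RintegralZl ?Rintegral_dotX_sqr//.
  by under eq_fun do rewrite /= expr2; apply: L4_integrable2; exact: L4_dotX.
under eq_bigr do rewrite E.
rewrite big_bool/= !(covXDl, covXDr, covXZl, covXZr) (covXC t s) expr0 expr1.
by field.
Qed.

Lemma Rintegral_dotX3 s t u :
  \int[P]_w (dotX s w * dotX t w * dotX u w) = 0.
Proof.
have i3 v : P.-integrable setT (fun w => (dotX v w ^+ 3)%:E).
  under eq_fun do rewrite !exprS expr0 mulr1 mulrA.
  by apply: L4_integrable3; exact: L4_dotX.
transitivity (\int[P]_w (\sum_(b : bool) \sum_(c : bool)
    e b * e c / 24 * (dotX (s + e b *: t + e c *: u) w ^+ 3))).
  apply: eq_Rintegral => w _; rewrite !big_bool/= !dotXD !dotXZ expr0 expr1.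
  by field.
rewrite Rintegral_bigsum; last first.
  by move=> b; apply: integrable_bigsum => c; apply: integrable_scale; exact: i3.
rewrite big1// => b _; rewrite Rintegral_bigsum; last first.
  by move=> c; apply: integrable_scale; exact: i3.
rewrite big1// => c _; rewrite RintegralZl ?Rintegral_dotX_cube ?mulr0//.
exact: i3.
Qed.

Lemma Rintegral_dotX4 s t u v :
  \int[P]_w (dotX s w * dotX t w * dotX u w * dotX v w) =
  covX s t * covX u v + covX s u * covX t v + covX s v * covX t u.
Proof.
have i4 x : P.-integrable setT (fun w => (dotX x w ^+ 4)%:E).
  by case: (L4_dotX x).
transitivity (\int[P]_w (\sum_(b : bool) \sum_(c : bool) \sum_(a : bool)
    e b * e c * e a / 192 *
    (dotX (s + e b *: t + e c *: u + e a *: v) w ^+ 4))).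
  apply: eq_Rintegral => w _; rewrite !big_bool/= !dotXD !dotXZ expr0 expr1.
  by field.
rewrite Rintegral_bigsum; last first.
  move=> b; apply: integrable_bigsum => c; apply: integrable_bigsum => a.
  by apply: integrable_scale; exact: i4.
have E (b c a : bool) : \int[P]_w (e b * e c * e a / 192 *
    (dotX (s + e b *: t + e c *: u + e a *: v) w ^+ 4)) =
    e b * e c * e a / 192 * (3 * covX (s + e b *: t + e c *: u + e a *: v)
                                  (s + e b *: t + e c *: u + e a *: v) ^+ 2).
  by rewrite RintegralZl ?Rintegral_dotX_X4//; exact: i4.
under eq_bigr => b _.
  rewrite Rintegral_bigsum; last first.
    move=> c; apply: integrable_bigsum => a.
    by apply: integrable_scale; exact: i4.
  under eq_bigr => c _.
    rewrite Rintegral_bigsum; last first.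
      by move=> a; apply: integrable_scale; exact: i4.
    under eq_bigr => a _ do rewrite E.
    over.
  over.
rewrite !big_bool/= !(covXDl, covXDr, covXZl, covXZr).
rewrite (covXC t s) (covXC u s) (covXC v s) (covXC u t) (covXC v t) (covXC v u).
by rewrite expr0 expr1; field.
Qed.

End gaussian_moments.

(** * The additive representation of the unified skew-normal law *)

Section nondegeneracy.
Context {R : realType}.

(** Moving [x] by [t *: (A *m x)] changes the form by
    [2 t N + t^2 c], where [N] is the squared norm of [A *m x]; this takes
    negative values for small negative [t] unless [N = 0]. *)
Lemma psdmx_null n (A : 'M[R]_n) (x : 'cV[R]_n) : psdmx A ->
  (x^T *m A *m x) 0 0 = 0 -> A *m x = 0.
Proof.
move=> [AT A0] xAx; set y := A *m x.
pose N := (y^T *m y) 0 0; pose c := (y^T *m A *m y) 0 0.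
have NE : N = \sum_i y i 0 ^+ 2.
  by rewrite /N mxE; apply: eq_bigr => i _; rewrite mxE expr2.
have c0 : 0 <= c by exact: A0.
have key (t : R) : 0 <= 2 * t * N + t ^+ 2 * c.
  have := A0 (x + t *: y).
  have -> : (x + t *: y)^T = x^T + t *: y^T by apply/matrixP => i j; rewrite !mxE.
  have xA : x^T *m A = y^T by rewrite /y trmx_mul AT.
  have yx : (y^T *m x) 0 0 = 0 by rewrite -xA.
  have yAx : y^T *m A *m x = y^T *m y by rewrite -mulmxA.
  rewrite mulmxDl -scalemxAl xA mulmxDl -!scalemxAl !mulmxDr -!scalemxAr yAx.
  move: yx; rewrite -/N /c; move: (y^T *m x) (y^T *m A *m y) @N NE c0 => p q N NE c0.
  by rewrite /N; move: (y^T *m y) => r; rewrite !mxE => ->; lra.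
have N0 : N = 0.
  apply/eqP; rewrite eq_le; apply/andP; split; last first.
    by rewrite NE sumr_ge0// => i _; exact: sqr_ge0.
  have c1 : 0 < c + 1 by rewrite ltr_pwDr.
  have := key (- (N / (c + 1))).
  have -> : 2 * - (N / (c + 1)) * N + (- (N / (c + 1))) ^+ 2 * c =
    - (N ^+ 2 * (c + 2) / (c + 1) ^+ 2) by field; rewrite gt_eqF.
  rewrite oppr_ge0 pmulr_lle0 ?invr_gt0 ?exprn_gt0// pmulr_lle0; last lra.
  move=> N2; have /eqP : N ^+ 2 = 0 by apply/le_anti; rewrite N2 sqr_ge0.
  by rewrite sqrf_eq0 => /eqP ->.
apply/matrixP => i j; rewrite ord1 [RHS]mxE.
move: N0; rewrite NE => /eqP; rewrite psumr_eq0; last by move=> k _; exact: sqr_ge0.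
by move=> /allP/(_ i (mem_index_enum i)); rewrite sqrf_eq0 => /eqP.
Qed.


Lemma psdmx_block n p (A : 'M[R]_n) (D : 'M[R]_(n, p)) (G : 'M[R]_p) :
  psdmx (block_mx A D D^T G) -> A^T = A /\ psdmx G.
Proof.
move=> [ST S0]; move: (ST); rewrite tr_block_mx => /eq_block_mx[AT _ _ GT].
split=> //; split=> // x; have := S0 (col_mx 0 x).
rewrite tr_col_mx mul_row_block mul_row_col trmx0 !mul0mx !add0r.
by rewrite mulmx0 add0r.
Qed.

(** A kernel vector of [G], extended by 0, is a null vector of the whole form. *)
Lemma dr_block_unitmx n p (A : 'M[R]_n) (D : 'M[R]_(n, p)) (G : 'M[R]_p) :
  psdmx (block_mx A D D^T G) -> \rank (block_mx A D D^T G) = (n + p)%N ->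
  G \in unitmx.
Proof.
move=> psdS rankS; have [_ [GT _]] := psdmx_block psdS.
rewrite -row_free_unit -kermx_eq0; apply/rowV0P => u /sub_kermxP uG.
pose x : 'cV[R]_(n + p) := col_mx 0 u^T.
have Sx : block_mx A D D^T G *m x = 0.
  apply: psdmx_null => //.
  rewrite tr_col_mx mul_row_block mul_row_col trmx0 !mul0mx !add0r trmxK uG.
  by rewrite mulmx0 mul0mx add0r mxE.
have fS : row_free (block_mx A D D^T G) by rewrite /row_free rankS.
have xS : x^T *m block_mx A D D^T G = 0.
  by rewrite -[_ *m _]trmxK trmx_mul trmxK psdS.1 Sx trmx0.
have : x^T = 0 by apply: (row_free_inj fS); rewrite /= mul0mx.
rewrite tr_col_mx trmx0 trmxK => /(congr1 (@rsubmx _ _ _ _)).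
by rewrite row_mxKr => ->; apply/matrixP => i j; rewrite !mxE.
Qed.

End nondegeneracy.

Lemma measurable_orthant (R : realType) m (tau : 'cV[R]_m) :
  measurable [set x : 'cV[R]_m | forall i, 0 < (x + tau) i 0].
Proof.
rewrite (_ : mkset _ = \bigcap_(i in [set: 'I_m])
    [set x : 'cV[R]_m | 0 < (x + tau) i 0]).
  apply: fin_bigcap_measurable => // i _.
  rewrite (_ : [set x : 'cV[R]_m | 0 < (x + tau) i 0] =
      (fun x : 'cV[R]_m => x i 0 + tau i 0) @^-1` `]0, +oo[).
    rewrite -[_ @^-1` _]setTI; apply: measurable_funD => //.
    exact: measurable_mx_entry.
  by apply/seteqP; split => x /=; rewrite in_itv/= andbT mxE.
by apply/seteqP; split => x /= Bx i; [move=> _|]; exact: Bx.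
Qed.

Section additive_representation.
Context {R : realType} (d m : nat).
Variables (Obar : 'M[R]_d) (Delta : 'M[R]_(d, m)) (Gamma : 'M[R]_m).
Variables (tau : 'cV[R]_m) (xi : 'cV[R]_d) (omega : 'M[R]_d).
Hypothesis psdS : psdmx (block_mx Obar Delta Delta^T Gamma).
Hypotheses (uG : Gamma \in unitmx) (omegaT : omega^T = omega).

Let Lambda := omega *m Delta *m invmx Gamma.
Let Psi := omega *m Obar *m omega
  - omega *m Delta *m invmx Gamma *m Delta^T *m omega.

Let GT : Gamma^T = Gamma. Proof. by have [_ []] := psdmx_block psdS. Qed.

Let LambdaT : Lambda^T = invmx Gamma *m Delta^T *m omega.
Proof. by rewrite /Lambda !trmx_mul trmx_inv GT omegaT mulmxA. Qed.

Let LambdaG : Lambda *m Gamma = omega *m Delta.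
Proof. by rewrite /Lambda mulmxKV. Qed.

Let PsiE : Psi = row_mx omega (- Lambda) *m block_mx Obar Delta Delta^T Gamma
  *m (row_mx omega (- Lambda))^T.
Proof.
rewrite tr_row_mx mul_row_block mul_row_col omegaT linearN/= LambdaT.
rewrite !mulNmx !mulmxN LambdaG subrr mul0mx subr0 mulmxBl /Psi /Lambda.
by rewrite ?mulmxA.
Qed.

Lemma psdmx_Psi : psdmx Psi.
Proof.
rewrite PsiE; split; first by rewrite !trmx_mul trmxK psdS.1 mulmxA.
move=> x; have := psdS.2 ((row_mx omega (- Lambda))^T *m x).
by rewrite trmx_mul trmxK !mulmxA.
Qed.

(** The residual of the regression of [omega X0] on [X1] is the image of the
    joint vector under [row_mx omega (- Lambda)]. *)
Lemma mvnormal0_residual d0 (T0 : measurableType d0) (P0 : probability T0 R)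
    (X0 : T0 -> 'cV[R]_d) (X1 : T0 -> 'cV[R]_m) :
  mvnormal0 P0 (fun w => col_mx (X0 w) (X1 w))
    (block_mx Obar Delta Delta^T Gamma) ->
  mvnormal0 P0 (fun w => omega *m X0 w - Lambda *m X1 w) Psi.
Proof.
move=> /(mvnormal0_mulmx (row_mx omega (- Lambda))); rewrite -PsiE.
move=> H t A mA; rewrite -H//; congr (P0 _); apply/funext => w /=.
by rewrite mul_row_col mulNmx.
Qed.

(** Regress [omega X0] on [X1]: jointly with [X1] it is distributed as
    [(Lambda W + H, W)] with [W] independent of [H].  Conditioning on
    [W + tau > 0] only affects the factor of [W], whose law becomes that
    of [U]. *)
Lemma SUN_additive d1 (T1 : measurableType d1) (P1 : probability T1 R)
    d2 (T2 : measurableType d2) (P2 : probability T2 R)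
    (Y : T1 -> 'cV[R]_d) (U : T2 -> 'cV[R]_m) (H : T2 -> 'cV[R]_d) :
  measurable_fun setT U -> measurable_fun setT H ->
  SUN P1 Y xi omega Obar Delta tau Gamma ->
  truncated_mvnormal0 P2 U tau Gamma -> mvnormal0 P2 H Psi ->
  independent_rv P2 U H ->
  same_law P1 P2 Y (fun w => xi + Lambda *m U w + H w).
Proof.
move=> mU mH [d0 [T0 [P0 [X0 [X1 [NX YE]]]]]].
move=> [d3 [T3 [P3 [W [NW UE]]]]] NH UH A mA.
pose B : set 'cV[R]_m := [set x | forall i, 0 < (x + tau) i 0].
have mB : measurable B by exact: measurable_orthant.
have mWB : measurable (W @^-1` B) by exact: measurable_funPTI.
have P3B : P3 (W @^-1` B) != 0%E by exact: same_law_cond_neq0 UE.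
have mW : measurable_fun setT W by [].
have joint : same_law P0 (P3 \x P2)%E
    (fun w => col_mx (omega *m X0 w) (X1 w))
    (fun z => col_mx (Lambda *m W z.1 + H z.2) (W z.1)).
  have mX0 : measurable_fun setT (fun w => omega *m X0 w).
    exact: measurable_mulmxl.
  have mX1 : measurable_fun setT X1 by [].
  have NX' : mvnormal0 P0 (fun w => col_mx (omega *m X0 w) (X1 w))
      (block_mx (omega *m Obar *m omega) (omega *m Delta)
                (omega *m Delta)^T Gamma).
    have := mvnormal0_mulmx (block_mx omega 0 0 1%:M) NX.
    rewrite tr_block_mx !mulmx_block !(trmx0, mulmx0, mul0mx, add0r, addr0).
    rewrite trmx1 mul1mx !mulmx1 mul1mx omegaT => H1 t C mC.
    rewrite trmx_mul omegaT -H1//; congr (P0 _); apply/funext => w /=.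
    by rewrite mul_block_col !mul0mx mul1mx add0r addr0.
  have psdG : psdmx Gamma by have [] := psdmx_block psdS.
  have AE : omega *m Obar *m omega = Lambda *m Gamma *m Lambda^T + Psi.
    by rewrite LambdaG LambdaT /Psi !mulmxA addrC subrK.
  exact: (same_law_regression mX0 mX1 mW mH NX' NW NH psdG psdmx_Psi AE
    (esym LambdaG)).
pose C : set 'cV[R]_(d + m) := [set z | A (xi + usubmx z)].
pose D : set 'cV[R]_(d + m) := [set z | B (dsubmx z)].
have mC : measurable C.
  rewrite -[C]setTI.
  have mxi : measurable_fun setT (fun z : 'cV[R]_(d + m) => xi + usubmx z).
    by apply: measurable_addmx => //; exact: measurable_usubmx.
  exact: mxi.
have mD : measurable D by rewrite -[D]setTI; exact: measurable_dsubmx.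
have JD : (fun z : T3 * T2 => col_mx (Lambda *m W z.1 + H z.2) (W z.1)) @^-1` D =
    (W @^-1` B) `*` setT.
  apply/seteqP; split => z /=; rewrite /D/= col_mxKd; first by [].
  by case.
have JC : (fun z : T3 * T2 => col_mx (Lambda *m W z.1 + H z.2) (W z.1)) @^-1` C =
    (fun z => (W z.1, H z.2)) @^-1` [set uh | A (xi + Lambda *m uh.1 + uh.2)].
  by apply/seteqP; split => z; rewrite /C/= col_mxKu addrA.
have mE : measurable [set uh : 'cV[R]_m * 'cV[R]_d |
    A (xi + Lambda *m uh.1 + uh.2)].
  rewrite -[mkset _]setTI.
  have mf : measurable_fun setT (fun uh : 'cV[R]_m * 'cV[R]_d =>
      xi + Lambda *m uh.1 + uh.2).
    apply: measurable_addmx => //; apply: measurable_addmx => //.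
    exact: measurable_mulmxl.
  exact: mf.
rewrite [LHS]YE//.
transitivity (cond_prob (P3 \x P2)%E ((fun z => (W z.1, H z.2)) @^-1`
    [set uh | A (xi + Lambda *m uh.1 + uh.2)]) ((W @^-1` B) `*` setT)).
  rewrite /cond_prob -JD -JC -preimage_setI -joint//; last exact: measurableI.
  rewrite -joint//; congr (P0 _ * (fine (P0 _))^-1%:E)%E.
    by apply/seteqP; split => w /=; rewrite /C/D/= col_mxKu col_mxKd.
  by apply/seteqP; split => w /=; rewrite /D/= col_mxKd.
rewrite (cond_product P2 mWB)//; last first.
  have mWH : measurable_fun setT (fun z : T3 * T2 => (W z.1, H z.2)).
    by apply: measurable_fun_pair; exact: measurableT_comp.
  by rewrite -[_ @^-1` _]setTI; exact: mWH.
have UW : same_law P2 (cond P3 mWB) U W.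
  by move=> F mF; rewrite [LHS]UE// -(condE mWB).
have HH : same_law P2 P2 H H by [].
exact/esym/(independent_pair_law mU mH mW mH UH UW HH mE).
Qed.

End additive_representation.


Section mixed_moments.
Context {R : realType}.

Lemma L4_same_law d1 (T1 : measurableType d1) (P1 : probability T1 R)
    d2 (T2 : measurableType d2) (P2 : probability T2 R) n
    (X : T1 -> 'cV[R]_n) (Y : T2 -> 'cV[R]_n) :
  measurable_fun setT X -> measurable_fun setT Y -> same_law P1 P2 X Y ->
  forall i, L4 P2 (fun w => Y w i 0) -> L4 P1 (fun w => X w i 0).
Proof.
move=> mX mY XY i [mYi Yi]; split; first by move/measurable_mxP : mX; exact.
have mf : measurable_fun setT (fun x : 'cV[R]_n => x i 0 ^+ 4).
  by apply: measurable_funX; exact: measurable_mx_entry.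
have YX A : measurable A -> P2 (Y @^-1` A) = P1 (X @^-1` A).
  by move=> mA; rewrite -XY.
exact: (law_integrable mY mX YX mf).
Qed.

Lemma L4_mulmx d (T : measurableType d) (P : probability T R) p q
    (A : 'M[R]_(p, q)) (X : T -> 'cV[R]_q) :
  (forall i, L4 P (fun w => X w i 0)) ->
  forall i, L4 P (fun w => (A *m X w) i 0).
Proof.
move=> LX i; under eq_fun do rewrite mxE.
by apply: L4_bigsum => j; exact: L4Z.
Qed.

Lemma L4_mvnormal0 d (T : measurableType d) (P : probability T R) n
    (X : T -> 'cV[R]_n) (S : 'M[R]_n) :
  measurable_fun setT X -> psdmx S -> mvnormal0 P X S ->
  forall i, L4 P (fun w => X w i 0).
Proof.
move=> mX psdS NX i.
have := L4_dotX mX psdS NX (delta_mx i 0); congr (L4 _ _).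
by apply/funext => w; rewrite /dotX trmx_delta -rowE mxE.
Qed.

(** The conditional law is bounded by a multiple of the unconditional one. *)
Lemma L4_cond d (T : measurableType d) (P : probability T R) (B : set T)
    (mB : measurable B) (f : T -> R) :
  P B != 0%E -> L4 P f -> L4 (cond P mB) f.
Proof.
move=> PB0 [mf fi]; split=> //; apply/integrableP; split.
  by apply/measurable_EFinP; exact: measurable_funX.
have c0 : 0 <= (fine (P B))^-1 by rewrite invr_ge0 fine_ge0.
apply: (@le_lt_trans _ _ (\int[mscale (NngNum c0) P]_w `|(f w ^+ 4)%:E|)%E).
  apply: ge0_le_measure_integral => //.
  - move=> A mA; rewrite [leLHS](condE mB)// /cond_prob /mscale/= muleC.
    rewrite lee_wpmul2l ?lee_fin// le_measure ?inE//; exact: measurableI.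
  - apply/measurable_EFinP; apply: measurableT_comp => //.
    exact: measurable_funX.
rewrite ge0_integral_mscale//.
  by case/integrableP : fi => _ fi; rewrite lte_mul_pinfty.
by apply/measurable_EFinP; apply: measurableT_comp => //; exact: measurable_funX.
Qed.

Lemma L4_truncated d (T : measurableType d) (P : probability T R) m
    (U : T -> 'cV[R]_m) tau (Gamma : 'M[R]_m) :
  measurable_fun setT U -> psdmx Gamma -> truncated_mvnormal0 P U tau Gamma ->
  forall i, L4 P (fun w => U w i 0).
Proof.
move=> mU psdG [d3 [T3 [P3 [W [NW UE]]]]] i.
have mWB : measurable (pos_part_event W tau).
  exact: (measurable_funPTI W (measurable_orthant tau)).
have P3B := same_law_cond_neq0 UE.
have mW : measurable_fun setT W by [].
have UW : same_law P (cond P3 mWB) U W.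
  by move=> F mF; rewrite [LHS]UE// -(condE mWB).
apply: (L4_same_law mU mW UW); apply: L4_cond => //.
exact: (L4_mvnormal0 mW psdG NW).
Qed.

End mixed_moments.

Section product_moments.
Context {R : realType} d1 (T1 : measurableType d1) (P1 : probability T1 R)
  d2 (T2 : measurableType d2) (P2 : probability T2 R).
Local Notation Q := (P1 \x P2)%E.
Local Notation integ P f := (P.-integrable setT (fun w => (f w)%:E)).

Lemma L4_fst f : L4 P1 f -> L4 Q (fun z => f z.1).
Proof.
move=> [mf fi]; split; first exact: measurableT_comp.
under eq_fun do rewrite -[_ ^+ _]mulr1.
by apply: (@integrable_prodM _ _ _ P1 _ _ P2 (fun w => f w ^+ 4) (cst 1)) => //;
  exact: integrable_const.
Qed.

Lemma L4_snd g : L4 P2 g -> L4 Q (fun z => g z.2).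
Proof.
move=> [mg gi]; split; first exact: measurableT_comp.
under eq_fun do rewrite -[_ ^+ _]mul1r.
by apply: (@integrable_prodM _ _ _ P1 _ _ P2 (cst 1) (fun w => g w ^+ 4)) => //;
  exact: integrable_const.
Qed.

Lemma Rintegral_fst f : integ P1 f -> \int[Q]_z f z.1 = \int[P1]_w f w.
Proof.
move=> fi; rewrite -[RHS]mulr1 -[1 in RHS](Rintegral_const P2) -Rintegral_prodM//.
  by apply: eq_Rintegral => z _; rewrite mulr1.
exact: integrable_const.
Qed.

(** The integrand is a sum of products of separate functions of the two
    coordinates.  The integrability hypothesis is a fold so that it unfolds to a
    conjunction when [s] is explicit. *)
Lemma Rintegral_prod_sum (s : seq ((T1 -> R) * (T2 -> R))) :
  foldr (fun p A => (integ P1 p.1 /\ integ P2 p.2) /\ A) True s ->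
  integ Q (fun z => \sum_(p <- s) p.1 z.1 * p.2 z.2) /\
  \int[Q]_z (\sum_(p <- s) p.1 z.1 * p.2 z.2) =
    \sum_(p <- s) (\int[P1]_w p.1 w) * (\int[P2]_w p.2 w).
Proof.
elim: s => [_|p s IH /= [[p1 p2] /IH[si sE]]].
  split; last by rewrite big_nil; under eq_Rintegral do rewrite big_nil;
    exact: Rintegral_const.
  by under eq_fun do rewrite big_nil; exact: integrable_const.
have pi := integrable_prodM p1 p2.
split; first by under eq_fun do rewrite big_cons; exact: integrable_add.
rewrite big_cons -sE -Rintegral_prodM// -RintegralD//.
by apply: eq_Rintegral => z _; rewrite big_cons.
Qed.

Variables (a1 a2 a3 a4 : T1 -> R) (g1 g2 g3 g4 : T2 -> R).
Hypotheses (La1 : L4 P1 a1) (La2 : L4 P1 a2) (La3 : L4 P1 a3) (La4 : L4 P1 a4).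
Hypotheses (Lg1 : L4 P2 g1) (Lg2 : L4 P2 g2) (Lg3 : L4 P2 g3) (Lg4 : L4 P2 g4).

Local Ltac L4int := repeat split; first
  [exact: integrable_const | exact: L4_integrable1 | exact: L4_integrable2 |
   exact: L4_integrable3 | exact: L4_integrable4].

Local Notation E1 f := (\int[P1]_w f w).
Local Notation E2 g := (\int[P2]_w g w).

Lemma Rintegral_prod_add2 :
  \int[Q]_z ((a1 z.1 + g1 z.2) * (a2 z.1 + g2 z.2)) =
  E1 (fun w => a1 w * a2 w) + E1 a1 * E2 g2 + E1 a2 * E2 g1
  + E2 (fun w => g1 w * g2 w).
Proof.
have [_] := @Rintegral_prod_sum [::
  (fun w => a1 w * a2 w, fun=> 1); (a1, g2); (a2, g1);
  (fun=> 1, fun w => g1 w * g2 w)] ltac:(L4int).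
rewrite !big_cons big_nil/= !Rintegral_const addr0 mulr1 mul1r !addrA => <-.
by apply: eq_Rintegral => z _; rewrite !big_cons big_nil/=; ring.
Qed.

Lemma Rintegral_prod_add3 :
  \int[Q]_z ((a1 z.1 + g1 z.2) * (a2 z.1 + g2 z.2) * (a3 z.1 + g3 z.2)) =
  E1 (fun w => a1 w * a2 w * a3 w)
  + E1 (fun w => a1 w * a2 w) * E2 g3 + E1 (fun w => a1 w * a3 w) * E2 g2
  + E1 (fun w => a2 w * a3 w) * E2 g1
  + E1 a1 * E2 (fun w => g2 w * g3 w) + E1 a2 * E2 (fun w => g1 w * g3 w)
  + E1 a3 * E2 (fun w => g1 w * g2 w)
  + E2 (fun w => g1 w * g2 w * g3 w).
Proof.
have [_] := @Rintegral_prod_sum [::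
  (fun w => a1 w * a2 w * a3 w, fun=> 1);
  (fun w => a1 w * a2 w, g3); (fun w => a1 w * a3 w, g2);
  (fun w => a2 w * a3 w, g1);
  (a1, fun w => g2 w * g3 w); (a2, fun w => g1 w * g3 w);
  (a3, fun w => g1 w * g2 w);
  (fun=> 1, fun w => g1 w * g2 w * g3 w)] ltac:(L4int).
rewrite !big_cons big_nil/= !Rintegral_const addr0 mulr1 mul1r !addrA => <-.
by apply: eq_Rintegral => z _; rewrite !big_cons big_nil/=; ring.
Qed.

Lemma Rintegral_prod_add4 :
  \int[Q]_z ((a1 z.1 + g1 z.2) * (a2 z.1 + g2 z.2) * (a3 z.1 + g3 z.2)
             * (a4 z.1 + g4 z.2)) =
  E1 (fun w => a1 w * a2 w * a3 w * a4 w)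
  + E1 (fun w => a1 w * a2 w * a3 w) * E2 g4
  + E1 (fun w => a1 w * a2 w * a4 w) * E2 g3
  + E1 (fun w => a1 w * a3 w * a4 w) * E2 g2
  + E1 (fun w => a2 w * a3 w * a4 w) * E2 g1
  + E1 (fun w => a1 w * a2 w) * E2 (fun w => g3 w * g4 w)
  + E1 (fun w => a1 w * a3 w) * E2 (fun w => g2 w * g4 w)
  + E1 (fun w => a1 w * a4 w) * E2 (fun w => g2 w * g3 w)
  + E1 (fun w => a2 w * a3 w) * E2 (fun w => g1 w * g4 w)
  + E1 (fun w => a2 w * a4 w) * E2 (fun w => g1 w * g3 w)
  + E1 (fun w => a3 w * a4 w) * E2 (fun w => g1 w * g2 w)
  + E1 a1 * E2 (fun w => g2 w * g3 w * g4 w)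
  + E1 a2 * E2 (fun w => g1 w * g3 w * g4 w)
  + E1 a3 * E2 (fun w => g1 w * g2 w * g4 w)
  + E1 a4 * E2 (fun w => g1 w * g2 w * g3 w)
  + E2 (fun w => g1 w * g2 w * g3 w * g4 w).
Proof.
have [_] := @Rintegral_prod_sum [::
  (fun w => a1 w * a2 w * a3 w * a4 w, fun=> 1);
  (fun w => a1 w * a2 w * a3 w, g4); (fun w => a1 w * a2 w * a4 w, g3);
  (fun w => a1 w * a3 w * a4 w, g2); (fun w => a2 w * a3 w * a4 w, g1);
  (fun w => a1 w * a2 w, fun w => g3 w * g4 w);
  (fun w => a1 w * a3 w, fun w => g2 w * g4 w);
  (fun w => a1 w * a4 w, fun w => g2 w * g3 w);
  (fun w => a2 w * a3 w, fun w => g1 w * g4 w);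
  (fun w => a2 w * a4 w, fun w => g1 w * g3 w);
  (fun w => a3 w * a4 w, fun w => g1 w * g2 w);
  (a1, fun w => g2 w * g3 w * g4 w); (a2, fun w => g1 w * g3 w * g4 w);
  (a3, fun w => g1 w * g2 w * g4 w); (a4, fun w => g1 w * g2 w * g3 w);
  (fun=> 1, fun w => g1 w * g2 w * g3 w * g4 w)] ltac:(L4int).
rewrite !big_cons big_nil/= !Rintegral_const addr0 mulr1 mul1r !addrA => <-.
by apply: eq_Rintegral => z _; rewrite !big_cons big_nil/=; ring.
Qed.

End product_moments.

Section shift_moments.
Context {R : realType} d (T : measurableType d) (P : probability T R).
Variables (f1 f2 f3 f4 : T -> R) (c1 c2 c3 c4 : R).
Hypotheses (L1 : L4 P f1) (L2 : L4 P f2) (L3 : L4 P f3) (L4' : L4 P f4).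
Local Notation E f := (\int[P]_w f w).

(** A constant is a function of an independent coordinate, so the expansions on
    product spaces apply. *)
Lemma Rintegral_shift3 :
  \int[P]_w ((f1 w + c1) * (f2 w + c2) * (f3 w + c3)) =
  E (fun w => f1 w * f2 w * f3 w)
  + E (fun w => f1 w * f2 w) * c3 + E (fun w => f1 w * f3 w) * c2
  + E (fun w => f2 w * f3 w) * c1
  + E f1 * (c2 * c3) + E f2 * (c1 * c3) + E f3 * (c1 * c2) + c1 * c2 * c3.
Proof.
have := Rintegral_prod_add3 L1 L2 L3
  (L4_cst P c1) (L4_cst P c2) (L4_cst P c3).
rewrite !Rintegral_const => <-.
rewrite (Rintegral_fst P
  (f := fun w => (f1 w + c1) * (f2 w + c2) * (f3 w + c3)))//.
by apply: L4_integrable3; apply: L4D => //; exact: L4_cst.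
Qed.

Lemma Rintegral_shift4 :
  \int[P]_w ((f1 w + c1) * (f2 w + c2) * (f3 w + c3) * (f4 w + c4)) =
  E (fun w => f1 w * f2 w * f3 w * f4 w)
  + E (fun w => f1 w * f2 w * f3 w) * c4
  + E (fun w => f1 w * f2 w * f4 w) * c3
  + E (fun w => f1 w * f3 w * f4 w) * c2
  + E (fun w => f2 w * f3 w * f4 w) * c1
  + E (fun w => f1 w * f2 w) * (c3 * c4)
  + E (fun w => f1 w * f3 w) * (c2 * c4)
  + E (fun w => f1 w * f4 w) * (c2 * c3)
  + E (fun w => f2 w * f3 w) * (c1 * c4)
  + E (fun w => f2 w * f4 w) * (c1 * c3)
  + E (fun w => f3 w * f4 w) * (c1 * c2)
  + E f1 * (c2 * c3 * c4) + E f2 * (c1 * c3 * c4)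
  + E f3 * (c1 * c2 * c4) + E f4 * (c1 * c2 * c3) + c1 * c2 * c3 * c4.
Proof.
have := Rintegral_prod_add4 L1 L2 L3 L4'
  (L4_cst P c1) (L4_cst P c2) (L4_cst P c3) (L4_cst P c4).
rewrite !Rintegral_const => <-.
rewrite (Rintegral_fst P
  (f := fun w => (f1 w + c1) * (f2 w + c2) * (f3 w + c3) * (f4 w + c4)))//.
by apply: L4_integrable4; apply: L4D => //; exact: L4_cst.
Qed.

End shift_moments.

(** * Entries of Kronecker products and of moment matrices *)

Section kronecker_entries.
Context {R : realType}.

Lemma tens_colE p q r (x : 'cV[R]_p) (B : 'M[R]_(q, r)) i j k :
  tens_col x B (mxtens_index (i, j)) k = x i 0 * B j k.
Proof.
rewrite /tens_col castmxE /= cast_ord_id mxE !mxtens_indexK/=.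
congr (x _ _ * B _ _); first exact: ord1.
by apply: val_inj; rewrite /= modn_small// -[X in (_ < X)%N](mul1n r).
Qed.

Lemma tens_rowE p q r (x : 'rV[R]_p) (B : 'M[R]_(q, r)) i k l :
  tens_row x B i (mxtens_index (k, l)) = x 0 k * B i l.
Proof.
rewrite /tens_row castmxE /= cast_ord_id mxE !mxtens_indexK/=.
congr (x _ _ * B _ _); first exact: ord1.
by apply: val_inj; rewrite /= modn_small// -[X in (_ < X)%N](mul1n q).
Qed.

Lemma tensE p q r s (A : 'M[R]_(p, q)) (B : 'M[R]_(r, s)) i j k l :
  (A *t B) (mxtens_index (i, j)) (mxtens_index (k, l)) = A i k * B j l.
Proof. by rewrite mxE !mxtens_indexK. Qed.

Lemma vecE p q (A : 'M[R]_(p, q)) i j z : vec A (mxtens_index (j, i)) z = A i j.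
Proof. by rewrite mxE mxtens_indexK. Qed.

Lemma commutation_mxE p q (i l : 'I_p) (j k : 'I_q) :
  commutation_mx p q (mxtens_index (i, j)) (mxtens_index (k, l)) =
  ((i == l) && (j == k))%:R :> R.
Proof.
have -> : commutation_mx p q (mxtens_index (i, j)) (mxtens_index (k, l)) =
    \sum_i' \sum_j' ((i == i') && (k == j'))%:R * ((l == i') && (j == j'))%:R :> R.
  rewrite /commutation_mx summxE; apply: eq_bigr => i' _.
  by rewrite summxE; apply: eq_bigr => j' _; rewrite tensE !mxE.
rewrite (bigD1 i)//= [X in _ + X]big1 ?addr0; last first.
  move=> i' i'i; rewrite big1// => j' _.
  by rewrite eq_sym (negbTE i'i) mul0r.
rewrite (bigD1 k)//= [X in _ + X]big1 ?addr0; last first.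
  by move=> j' j'k; rewrite [k == j']eq_sym (negbTE j'k) andbF mul0r.
by rewrite !eqxx mul1r [l == i]eq_sym.
Qed.

Lemma mul_commutation_mx n r (M : 'M[R]_(n * n, r)) i j k :
  (commutation_mx n n *m M) (mxtens_index (i, j)) k = M (mxtens_index (j, i)) k.
Proof.
rewrite mxE (bigD1 (mxtens_index (j, i)))//= commutation_mxE !eqxx mul1r.
rewrite big1 ?addr0// => a; case: (mxtens_indexP a) => k' l' ne.
rewrite commutation_mxE; case: eqP => [il|]; case: eqP => [jk|];
  rewrite ?mul0r//=.
by move: ne; rewrite -il -jk eqxx.
Qed.

Lemma mulmx_commutation n r (M : 'M[R]_(r, n * n)) i j k :
  (M *m commutation_mx n n) k (mxtens_index (i, j)) = M k (mxtens_index (j, i)).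
Proof.
rewrite mxE (bigD1 (mxtens_index (j, i)))//= commutation_mxE !eqxx mulr1.
rewrite big1 ?addr0// => a; case: (mxtens_indexP a) => k' l' ne.
rewrite commutation_mxE; case: eqP => [il|]; case: eqP => [jk|];
  rewrite ?mulr0//=.
by move: ne; rewrite il jk eqxx.
Qed.

Lemma col_rowE p q (x : 'cV[R]_p) (y : 'cV[R]_q) i j :
  (x *m y^T) i j = x i 0 * y j 0.
Proof. by rewrite mxE big_ord1 mxE. Qed.

Lemma addmxE p q (A B : 'M[R]_(p, q)) i j : (A + B) i j = A i j + B i j.
Proof. by rewrite mxE. Qed.

Lemma oppmxE p q (A : 'M[R]_(p, q)) i j : (- A) i j = - A i j.
Proof. by rewrite mxE. Qed.

Lemma scalemxE p q c (A : 'M[R]_(p, q)) i j : (c *: A) i j = c * A i j.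
Proof. by rewrite mxE. Qed.

(** In this form the mixed-product rule of [*t] applies to the third moment. *)
Lemma tens_col_outer q (x : 'cV[R]_q) :
  tens_col x (x *m x^T) = (x *t x : 'M[R]_(q * q, 1)) *m x^T.
Proof.
apply/matrixP => a k; case: (mxtens_indexP a) => i j.
rewrite tens_colE col_rowE mxE big_ord1 [in RHS]mxE mxtens_indexK/= [x^T _ _]mxE mulrA.
by congr (x _ _ * x _ _ * _); rewrite [RHS]ord1.
Qed.

End kronecker_entries.

Section moment_entries.
Context {R : realType} d (T : measurableType d) (P : probability T R) (n : nat).

Lemma mx_expectationE p q (X : T -> 'M[R]_(p, q)) i j :
  mx_expectation P X i j = \int[P]_w X w i j.
Proof. by rewrite mxE unlock. Qed.

Lemma mx_expectation_mul p q r s (A : 'M[R]_(p, q)) (X : T -> 'M[R]_(q, r))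
    (B : 'M[R]_(r, s)) :
  (forall i j, P.-integrable setT (fun w => (X w i j)%:E)) ->
  mx_expectation P (fun w => A *m X w *m B) = A *m mx_expectation P X *m B.
Proof.
move=> iX; apply/matrixP => i j; rewrite mx_expectationE mxE.
have iAX k : P.-integrable setT (fun w => ((A *m X w) i k)%:E).
  under eq_fun do rewrite mxE; apply: integrable_bigsum => l.
  exact: integrable_scale.
under eq_Rintegral do rewrite mxE.
rewrite Rintegral_bigsum; last first.
  by move=> k; under eq_fun do rewrite mulrC; exact: integrable_scale.
apply: eq_bigr => k _; rewrite RintegralZr//; last exact: iAX.
have -> // : (A *m mx_expectation P X) i k = \int[P]_w (A *m X w) i k.
under eq_Rintegral do rewrite mxE.
rewrite Rintegral_bigsum; last by move=> l; exact: integrable_scale.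
rewrite mxE; apply: eq_bigr => l _.
by rewrite RintegralZl ?mx_expectationE//; exact: iX.
Qed.

Lemma mu1E (X : T -> 'cV[R]_n) i : mu1 P X i 0 = \int[P]_w X w i 0.
Proof. exact: mx_expectationE. Qed.

Lemma mu2E (X : T -> 'cV[R]_n) i j : mu2 P X i j = \int[P]_w (X w i 0 * X w j 0).
Proof. by rewrite mx_expectationE; apply: eq_Rintegral => w _; exact: col_rowE. Qed.

Lemma mu3E (X : T -> 'cV[R]_n) i j k :
  mu3 P X (mxtens_index (i, j)) k = \int[P]_w (X w i 0 * X w j 0 * X w k 0).
Proof.
rewrite mx_expectationE; apply: eq_Rintegral => w _.
by rewrite tens_colE col_rowE mulrA.
Qed.

Lemma mu4E (X : T -> 'cV[R]_n) i j k l :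
  mu4 P X (mxtens_index (i, j)) (mxtens_index (k, l)) =
  \int[P]_w (X w i 0 * X w j 0 * X w k 0 * X w l 0).
Proof.
rewrite mx_expectationE; apply: eq_Rintegral => w _.
by rewrite tensE !col_rowE; ring.
Qed.

Variable X : T -> 'cV[R]_n.
Hypothesis LX : forall i, L4 P (fun w => X w i 0).

Lemma mu2_mulmx p (L : 'M[R]_(p, n)) :
  mu2 P (fun w => L *m X w) = L *m mu2 P X *m L^T.
Proof.
rewrite -mx_expectation_mul.
  by congr (mx_expectation P _); apply/funext => w; rewrite trmx_mul !mulmxA.
by move=> i j; under eq_fun do rewrite col_rowE; exact: L4_integrable2.
Qed.

Lemma mu3_mulmx p (L : 'M[R]_(p, n)) :
  mu3 P (fun w => L *m X w) = (L *t L) *m mu3 P X *m L^T.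
Proof.
rewrite -mx_expectation_mul.
  congr (mx_expectation P _); apply/funext => w.
  have LL : (L *m X w) *t (L *m X w) = (L *t L) *m (X w *t X w).
    by rewrite tensmx_mul.
  by rewrite !tens_col_outer trmx_mul LL !mulmxA.
move=> a k; case: (mxtens_indexP a) => i j.
by under eq_fun do rewrite tens_colE col_rowE mulrA; exact: L4_integrable3.
Qed.

Lemma mu4_mulmx p (L : 'M[R]_(p, n)) :
  mu4 P (fun w => L *m X w) = (L *t L) *m mu4 P X *m (L *t L)^T.
Proof.
rewrite -mx_expectation_mul.
  congr (mx_expectation P _); apply/funext => w.
  by rewrite trmx_tens !tensmx_mul trmx_mul !mulmxA.
move=> a b; case: (mxtens_indexP a) => i j; case: (mxtens_indexP b) => k l.
under eq_fun do rewrite tensE !col_rowE mulrA.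
exact: L4_integrable4.
Qed.

Lemma mu2C i j : mu2 P X i j = mu2 P X j i.
Proof. by rewrite !mu2E; apply: eq_Rintegral => w _; rewrite mulrC. Qed.

Lemma mu3_perm i j k :
  mu3 P X (mxtens_index (i, j)) k = mu3 P X (mxtens_index (k, i)) j.
Proof. by rewrite !mu3E; apply: eq_Rintegral => w _; ring. Qed.

Let X0 w := X w - mu1 P X.

Let X0E w i : X0 w i 0 = X w i 0 + (- mu1 P X i 0).
Proof. by rewrite /X0 !mxE. Qed.

Lemma mu3_center :
  mu3 P X0 =
    (1%:M + commutation_mx n n)
      *m (tens_col (mu1 P X) (mu1 P X *m (mu1 P X)^T)
          - tens_col (mu1 P X) (mu2 P X))
    - vec (mu2 P X) *m (mu1 P X)^T + mu3 P X.
Proof.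
apply/matrixP => a k; case: (mxtens_indexP a) => i j.
rewrite mu3E; under eq_Rintegral do rewrite !X0E.
rewrite Rintegral_shift3// -!mu2E -!mu3E -!mu1E.
rewrite mulmxDl mul1mx !(addmxE, oppmxE, mul_commutation_mx, tens_colE,
  col_rowE, vecE).
rewrite (mu2C j i); ring.
Qed.

Lemma mu4_center :
  mu4 P X0 =
    - 3 *: ((mu1 P X *m (mu1 P X)^T) *t (mu1 P X *m (mu1 P X)^T))
    + (1%:M + commutation_mx n n)
      *m ((mu1 P X *m (mu1 P X)^T) *t mu2 P X
          + mu2 P X *t (mu1 P X *m (mu1 P X)^T)
          - tens_col (mu1 P X) 1%:M *m (mu3 P X)^T)
    - mu3 P X *m tens_row (mu1 P X)^T 1%:M *m (1%:M + commutation_mx n n)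
    + vec (mu2 P X) *m (tens_col (mu1 P X) (mu1 P X))^T
    + tens_col (mu1 P X) (mu1 P X) *m (vec (mu2 P X))^T
    + mu4 P X.
Proof.
apply/matrixP => a b.
case: (mxtens_indexP a) => i j; case: (mxtens_indexP b) => k l.
have E1 i' j' k' l' : (tens_col (mu1 P X) 1%:M *m (mu3 P X)^T)
    (mxtens_index (i', j')) (mxtens_index (k', l')) =
    mu1 P X i' 0 * mu3 P X (mxtens_index (k', l')) j'.
  rewrite mxE (bigD1 j')//= big1 ?addr0; last first.
    move=> r rj; rewrite tens_colE [1%:M _ _]mxE eq_sym (negbTE rj).
    by rewrite mulr0 mul0r.
  by rewrite tens_colE [1%:M _ _]mxE eqxx mulr1 [_^T _ _]mxE.
have E2 i' j' k' l' : (mu3 P X *m tens_row (mu1 P X)^T 1%:M)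
    (mxtens_index (i', j')) (mxtens_index (k', l')) =
    mu1 P X k' 0 * mu3 P X (mxtens_index (i', j')) l'.
  rewrite mxE (bigD1 l')//= big1 ?addr0; last first.
    by move=> r rl; rewrite tens_rowE [1%:M _ _]mxE (negbTE rl) !mulr0.
  by rewrite tens_rowE [1%:M _ _]mxE eqxx mulr1 [_^T _ _]mxE mulrC.
rewrite mu4E; under eq_Rintegral do rewrite !X0E.
rewrite Rintegral_shift4// -!mu2E -!mu3E -!mu4E -!mu1E.
rewrite mulmxDl mul1mx mulmxDr mulmx1.
rewrite !(addmxE, oppmxE, scalemxE, mul_commutation_mx, mulmx_commutation,
  E1, E2, tens_colE, col_rowE, vecE, tensE).
rewrite (mu2C j i) (mu2C l k) (mu3_perm k l j) (mu3_perm k l i).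
ring.
Qed.

End moment_entries.

(** * Mardia's measures of a centred Gaussian mixture *)

Section traces.
Context {R : realType}.

Lemma sum_mxtens p q (F : 'I_(p * q) -> R) :
  \sum_r F r = \sum_i \sum_j F (mxtens_index (i, j)).
Proof.
rewrite pair_bigA; apply: reindex => /=.
exists (@mxtens_unindex p q) => r _; last exact: mxtens_unindexK.
by rewrite mxtens_indexK; case: r.
Qed.

Lemma mxtrace_tens p q (A : 'M[R]_p) (B : 'M[R]_q) :
  \tr (A *t B) = \tr A * \tr B.
Proof.
rewrite /mxtrace sum_mxtens mulr_suml; apply: eq_bigr => i _.
by rewrite mulr_sumr; apply: eq_bigr => j _; rewrite tensE.
Qed.

Lemma mxtrace_commutation_tens n (A B : 'M[R]_n) :
  \tr (commutation_mx n n *m (A *t B)) = \tr (A *m B).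
Proof.
rewrite /mxtrace sum_mxtens exchange_big; apply: eq_bigr => i _.
by rewrite mxE; apply: eq_bigr => j _; rewrite mul_commutation_mx tensE.
Qed.

Lemma mxtrace_vec p q (A B : 'M[R]_(p, q)) :
  \tr (vec A *m (vec B)^T) = \tr (A *m B^T).
Proof.
rewrite /mxtrace sum_mxtens exchange_big; apply: eq_bigr => i _.
by rewrite mxE; apply: eq_bigr => j _; rewrite col_rowE !vecE mxE.
Qed.

Lemma dot_vec p q (A B : 'M[R]_(p, q)) :
  ((vec A)^T *m vec B) 0 0 = \tr (A *m B^T).
Proof.
rewrite -mxtrace_vec mxtrace_mulC -[RHS]/(\tr _) mxtrace_mulC /mxtrace mxE.
by apply: eq_bigr => r _; rewrite col_rowE mxE.
Qed.

Lemma tens_mul_vec p q (A : 'M[R]_p) (B : 'M[R]_q) (M : 'M[R]_(p, q)) :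
  (B *t A) *m vec M = vec (A *m M *m B^T).
Proof.
apply/matrixP => a z; case: (mxtens_indexP a) => j i.
rewrite mxE sum_mxtens vecE mxE; apply: eq_bigr => j' _.
rewrite mxE mulr_suml; apply: eq_bigr => i' _.
by rewrite tensE vecE mxE; ring.
Qed.

Lemma mxtrace_tens_congr p q (L : 'M[R]_(p, q)) (M : 'M[R]_(q * q)) :
  \tr ((L *t L) *m M *m (L *t L)^T) = \tr (((L^T *m L) *t (L^T *m L)) *m M).
Proof. by rewrite mxtrace_mulC mulmxA trmx_tens tensmx_mul. Qed.

Lemma mxtrace_third_moment p q (L : 'M[R]_(p, q)) (M : 'M[R]_(q * q, q)) :
  let X := (L *t L) *m M *m L^T in
  \tr (X *m X^T) =
  \tr (((L^T *m L) *t (L^T *m L)) *m M *m (L^T *m L) *m M^T).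
Proof.
move=> X.
have -> : X *m X^T = (L *t L) *m (M *m (L^T *m L) *m M^T) *m (L *t L)^T.
  by rewrite /X !trmx_mul trmxK !mulmxA.
by rewrite mxtrace_tens_congr !mulmxA.
Qed.

(** The trace of the Gaussian part of a fourth moment matrix; the commutation
    matrix turns a Kronecker product into an ordinary one under the trace. *)
Lemma mxtrace_isserlis n (A B : 'M[R]_n) : A^T = A -> B^T = B ->
  \tr ((1%:M + commutation_mx n n) *m (A *t B + B *t A + B *t B)
        + vec A *m (vec B)^T + vec B *m (vec A)^T + vec B *m (vec B)^T) =
  2 * \tr A * \tr B + \tr B ^+ 2 + 4 * \tr (A *m B) + 2 * \tr (B *m B).
Proof.
move=> AT BT; rewrite !mxtraceD mulmxDl mul1mx !mulmxDr !mxtraceD.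
rewrite !mxtrace_tens !mxtrace_commutation_tens !mxtrace_vec AT BT.
by rewrite (mxtrace_mulC B A); ring.
Qed.

Section mahalanobis_traces.
Variables (p q : nat) (C Psi : 'M[R]_p) (Lam : 'M[R]_(p, q)) (S : 'M[R]_q).
Local Notation W := (C^T *m C).

Lemma mxtrace_congr : \tr (C *m Psi *m C^T) = \tr (Psi *m W).
Proof. by rewrite -mulmxA mxtrace_mulC -mulmxA. Qed.

Lemma mxtrace_congr_low :
  \tr ((C *m Lam) *m S *m (C *m Lam)^T) = \tr (S *m (Lam^T *m W *m Lam)).
Proof. by rewrite -mulmxA mxtrace_mulC trmx_mul !mulmxA. Qed.

Lemma mxtrace_congr2 :
  \tr ((C *m Psi *m C^T) *m (C *m Psi *m C^T)) = \tr (Psi *m W *m Psi *m W).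
Proof.
rewrite (_ : _ *m _ = C *m (Psi *m W *m Psi *m C^T)); last by rewrite !mulmxA.
by rewrite mxtrace_mulC !mulmxA.
Qed.

Lemma mxtrace_congr_low_congr :
  \tr (((C *m Lam) *m S *m (C *m Lam)^T) *m (C *m Psi *m C^T)) =
  \tr (S *m Lam^T *m W *m Psi *m W *m Lam).
Proof.
rewrite trmx_mul (_ : _ *m _ =
  (C *m Lam) *m (S *m Lam^T *m W *m Psi *m C^T)); last by rewrite !mulmxA.
by rewrite mxtrace_mulC !mulmxA.
Qed.

End mahalanobis_traces.

End traces.

Section gaussian_entries.
Context {R : realType} d (T : measurableType d) (P : probability T R) (n : nat).
Variables (G : T -> 'cV[R]_n) (S : 'M[R]_n).
Hypotheses (mG : measurable_fun setT G) (psdS : psdmx S) (NG : mvnormal0 P G S).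

Let GE w i : G w i 0 = dotX G (delta_mx i 0) w.
Proof. by rewrite /dotX trmx_delta -rowE mxE. Qed.

Let covE i j : covX S (delta_mx i 0) (delta_mx j 0) = S i j.
Proof. by rewrite /covX trmx_delta -rowE -colE !mxE. Qed.

Lemma mvnormal0_E1 i : \int[P]_w G w i 0 = 0.
Proof. by under eq_Rintegral do rewrite GE; exact: Rintegral_dotX1 NG _. Qed.

Lemma mvnormal0_E2 i j : \int[P]_w (G w i 0 * G w j 0) = S i j.
Proof.
under eq_Rintegral do rewrite !GE.
by rewrite (Rintegral_dotX2 mG psdS NG) covE.
Qed.

Lemma mvnormal0_E3 i j k : \int[P]_w (G w i 0 * G w j 0 * G w k 0) = 0.
Proof.
under eq_Rintegral do rewrite !GE.
exact: (Rintegral_dotX3 mG psdS NG).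
Qed.

Lemma mvnormal0_E4 i j k l :
  \int[P]_w (G w i 0 * G w j 0 * G w k 0 * G w l 0) =
  S i j * S k l + S i k * S j l + S i l * S j k.
Proof.
under eq_Rintegral do rewrite !GE.
by rewrite (Rintegral_dotX4 mG psdS NG) !covE.
Qed.

End gaussian_entries.

Section gaussian_mixture.
Context {R : realType} d (T : measurableType d) (P : probability T R)
  d1 (T1 : measurableType d1) (P1 : probability T1 R)
  d2 (T2 : measurableType d2) (P2 : probability T2 R) (n : nat).
Variables (Z : T -> 'cV[R]_n) (A : T1 -> 'cV[R]_n) (G : T2 -> 'cV[R]_n).
Variable Psi : 'M[R]_n.
Hypotheses (mZ : measurable_fun setT Z) (mA : measurable_fun setT A)
  (mG : measurable_fun setT G).
Hypothesis LA : forall i, L4 P1 (fun w => A w i 0).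
Hypotheses (psdPsi : psdmx Psi) (NG : mvnormal0 P2 G Psi).
Hypothesis ZE : same_law P (P1 \x P2)%E Z (fun z => A z.1 + G z.2).

Let LG : forall i, L4 P2 (fun w => G w i 0).
Proof. exact: (L4_mvnormal0 mG psdPsi NG). Qed.

Let mAG : measurable_fun setT (fun z : T1 * T2 => A z.1 + G z.2).
Proof. by apply: measurable_addmx; exact: measurableT_comp. Qed.

Lemma mixture_L4 i : L4 P (fun w => Z w i 0).
Proof.
apply: (L4_same_law mZ mAG ZE).
under eq_fun do rewrite addmxE.
apply: L4D; first exact: (L4_fst P2 (LA i)).
exact: (L4_snd P1 (LG i)).
Qed.

Let transfer (f : 'cV[R]_n -> R) : measurable_fun setT f ->
  \int[P]_w f (Z w) = \int[(P1 \x P2)%E]_z f (A z.1 + G z.2).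
Proof. by move=> mf; exact: (law_Rintegral mZ mAG ZE mf). Qed.

Let entry i := @measurable_mx_entry R n 1 i 0.

Lemma mixture_mu1 : mu1 P Z = mu1 P1 A.
Proof.
apply/matrixP => i j; rewrite ord1 !mu1E (transfer (entry i)).
under eq_Rintegral do rewrite addmxE.
have := Rintegral_prod_add2 (LA i) (L4_cst P1 0) (LG i) (L4_cst P2 1).
have -> : \int[(P1 \x P2)%E]_z ((A z.1 i 0 + G z.2 i 0) * (0 + 1)) =
  \int[(P1 \x P2)%E]_z (A z.1 i 0 + G z.2 i 0).
  by apply: eq_Rintegral => z _; rewrite add0r mulr1.
move=> ->; rewrite !Rintegral_const mulr1 mul0r addr0.
under eq_Rintegral do rewrite mulr0.
rewrite Rintegral_const add0r.
under [X in _ + X]eq_Rintegral do rewrite mulr1.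
by rewrite (mvnormal0_E1 mG psdPsi NG) addr0.
Qed.

Hypothesis A1 : mu1 P1 A = 0.

Let EA i : \int[P1]_w A w i 0 = 0.
Proof. by rewrite -mu1E A1 mxE. Qed.

(** All mixed terms contain a first moment of [A], a first or a third moment of
    [G]. *)
Lemma mixture_mu3 : mu3 P Z = mu3 P1 A.
Proof.
apply/matrixP => a k; case: (mxtens_indexP a) => i j; rewrite !mu3E.
rewrite (transfer (f := fun x => x i 0 * x j 0 * x k 0)); last first.
  by do 2 (apply: measurable_funM; last exact: entry); exact: entry.
under eq_Rintegral do rewrite !addmxE.
rewrite (Rintegral_prod_add3 (LA i) (LA j) (LA k) (LG i) (LG j) (LG k)).
rewrite !EA !(mvnormal0_E1 mG psdPsi NG) (mvnormal0_E3 mG psdPsi NG).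
by rewrite !mulr0 !mul0r !addr0.
Qed.

(** The surviving terms of the expansion are the fourth moments of [A], the six
    ways of assigning two of the four indices to [A] and two to [G], and the
    three pairings of Isserlis' formula. *)
Lemma mixture_mu4 :
  let S := mu2 P1 A in
  mu4 P Z = mu4 P1 A
    + (1%:M + commutation_mx n n) *m (S *t Psi + Psi *t S + Psi *t Psi)
    + vec S *m (vec Psi)^T + vec Psi *m (vec S)^T + vec Psi *m (vec Psi)^T.
Proof.
move=> S; apply/matrixP => a b.
case: (mxtens_indexP a) => i j; case: (mxtens_indexP b) => k l.
have PsiC x y : Psi x y = Psi y x by rewrite -{1}psdPsi.1 mxE.
rewrite mu4E (transfer (f := fun x => x i 0 * x j 0 * x k 0 * x l 0)); last first.
  by do 3 (apply: measurable_funM; last exact: entry); exact: entry.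
under eq_Rintegral do rewrite !addmxE.
rewrite (Rintegral_prod_add4 (LA i) (LA j) (LA k) (LA l)
  (LG i) (LG j) (LG k) (LG l)).
rewrite !EA !(mvnormal0_E1 mG psdPsi NG) !(mvnormal0_E3 mG psdPsi NG).
rewrite !(mvnormal0_E2 mG psdPsi NG) (mvnormal0_E4 mG psdPsi NG).
rewrite -!mu2E -!mu4E -/S mulmxDl mul1mx.
rewrite !(addmxE, mul_commutation_mx, tensE, col_rowE, vecE).
rewrite [S j i]mu2C -/S [S l k]mu2C -/S (PsiC j i) (PsiC l k).
ring.
Qed.

End gaussian_mixture.

Section standardized_mardia.
Context {R : realType} d (T : measurableType d) (P : probability T R) (n : nat).
Variable Z : T -> 'cV[R]_n.
Hypothesis LZ : forall i, L4 P (fun w => Z w i 0).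
Hypotheses (Z1 : mu1 P Z = 0) (Z2 : variance_mx P Z = 1%:M).

Let dotE (x y : 'cV[R]_n) : (x^T *m y) 0 0 = \sum_i x i 0 * y i 0.
Proof. by rewrite mxE; apply: eq_bigr => i _; rewrite mxE. Qed.

(** The cube of the inner product of two independent copies is the sum over all
    index triples of a product of equal functions of the two copies. *)
Lemma mardia_skewness_mu3 :
  mardia_skewness P Z = \tr (mu3 P Z *m (mu3 P Z)^T).
Proof.
rewrite /mardia_skewness Z1 Z2 invmx1.
have iZ i j k : P.-integrable setT (EFin \o (fun w => Z w i 0 * Z w j 0 * Z w k 0)).
  exact: (L4_integrable3 (LZ i) (LZ j) (LZ k)).
have iP i j k : ((P \x P)%E : probability _ R).-integrable setT
    (fun z => ((Z z.1 i 0 * Z z.1 j 0 * Z z.1 k 0) *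
               (Z z.2 i 0 * Z z.2 j 0 * Z z.2 k 0))%:E).
  exact: (integrable_prodM (iZ i j k) (iZ i j k)).
transitivity (\int[(P \x P)%E]_z (\sum_i \sum_j \sum_k
    (Z z.1 i 0 * Z z.1 j 0 * Z z.1 k 0) * (Z z.2 i 0 * Z z.2 j 0 * Z z.2 k 0))).
  apply: eq_Rintegral => z _; rewrite !subr0 mulmx1 dotE.
  rewrite !exprS expr0 mulr1 mulr_suml; apply: eq_bigr => i _.
  rewrite -mulrA mulr_suml !mulr_sumr; apply: eq_bigr => j _.
  rewrite !mulr_sumr; apply: eq_bigr => k _.
  by ring.
rewrite Rintegral_bigsum; last first.
  by move=> i; apply: integrable_bigsum => j; apply: integrable_bigsum => k.
rewrite /mxtrace sum_mxtens; apply: eq_bigr => i _.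
rewrite Rintegral_bigsum; last by move=> j; apply: integrable_bigsum => k.
apply: eq_bigr => j _; rewrite Rintegral_bigsum// mxE; apply: eq_bigr => k _.
by rewrite [_^T _ _]mxE !mu3E; exact: (Rintegral_prodM (iZ i j k) (iZ i j k)).
Qed.

Lemma mardia_kurtosis_mu4 : mardia_kurtosis P Z = \tr (mu4 P Z).
Proof.
rewrite /mardia_kurtosis unlock Z1 Z2 invmx1 -/(Rintegral P setT _).
transitivity (\int[P]_w (\sum_i \sum_j (Z w i 0 * Z w j 0 * Z w i 0 * Z w j 0))).
  apply: eq_Rintegral => w _; rewrite subr0 mulmx1 dotE.
  rewrite expr2 mulr_suml; apply: eq_bigr => i _.
  by rewrite mulr_sumr; apply: eq_bigr => j _; ring.
have i4 i j : P.-integrable setT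
    (fun w => (Z w i 0 * Z w j 0 * Z w i 0 * Z w j 0)%:E).
  exact: L4_integrable4.
rewrite Rintegral_bigsum; last by move=> i; exact: integrable_bigsum.
rewrite /mxtrace sum_mxtens; apply: eq_bigr => i _.
by rewrite Rintegral_bigsum//; apply: eq_bigr => j _; rewrite mu4E.
Qed.

End standardized_mardia.

(** * Laws on product spaces and affine standardization *)

Section product_laws.
Context {R : realType} d1 (T1 : measurableType d1) (P1 : probability T1 R)
  d2 (T2 : measurableType d2) (P2 : probability T2 R).
Local Notation Q := (P1 \x P2)%E.

Lemma same_law_fst n (X : T1 -> 'cV[R]_n) : measurable_fun setT X ->
  same_law Q P1 (fun z => X z.1) X.
Proof.
move=> mX A mA; have mXA : measurable (X @^-1` A).
  by rewrite -[_ @^-1` _]setTI; exact: mX.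
transitivity (Q ((X @^-1` A) `*` setT)).
  by congr (Q _); apply/seteqP; split => z //= [].
rewrite product_measure1E// -[RHS]mule1; congr (_ * _)%E.
exact: probability_setT.
Qed.

Lemma same_law_snd n (X : T2 -> 'cV[R]_n) : measurable_fun setT X ->
  same_law Q P2 (fun z => X z.2) X.
Proof.
move=> mX A mA; have mXA : measurable (X @^-1` A).
  by rewrite -[_ @^-1` _]setTI; exact: mX.
transitivity (Q (setT `*` (X @^-1` A))).
  by congr (Q _); apply/seteqP; split => z //= [].
rewrite product_measure1E// -[RHS]mul1e; congr (_ * _)%E.
exact: probability_setT.
Qed.

Lemma independent_fst_snd m n (X : T1 -> 'cV[R]_m) (Y : T2 -> 'cV[R]_n) :
  measurable_fun setT X -> measurable_fun setT Y ->
  independent_rv Q (fun z => X z.1) (fun z => Y z.2).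
Proof.
move=> mX mY A B mA mB.
rewrite (same_law_fst mX mA) (same_law_snd mY mB).
transitivity (Q ((X @^-1` A) `*` (Y @^-1` B))); first by [].
rewrite product_measure1E//.
- by rewrite -[_ @^-1` _]setTI; exact: mX.
- by rewrite -[_ @^-1` _]setTI; exact: mY.
Qed.

End product_laws.

Section affine_maps.
Context {R : realType}.

Lemma same_law_comp d1 (T1 : measurableType d1) (P1 : probability T1 R)
    d2 (T2 : measurableType d2) (P2 : probability T2 R) n p
    (X : T1 -> 'cV[R]_n) (Y : T2 -> 'cV[R]_n) (f : 'cV[R]_n -> 'cV[R]_p) :
  measurable_fun setT f -> same_law P1 P2 X Y ->
  same_law P1 P2 (f \o X) (f \o Y).
Proof.
move=> mf XY A mA; apply: (XY (f @^-1` A)).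
by rewrite -[_ @^-1` _]setTI; exact: mf.
Qed.

Lemma same_law_mvnormal0_trans d1 (T1 : measurableType d1)
    (P1 : probability T1 R) d2 (T2 : measurableType d2) (P2 : probability T2 R)
    n (X : T1 -> 'cV[R]_n) (Y : T2 -> 'cV[R]_n) (S : 'M[R]_n) :
  same_law P1 P2 X Y -> mvnormal0 P2 Y S -> mvnormal0 P1 X S.
Proof.
move=> XY NY t A mA; rewrite -NY//.
apply: (XY ((fun x => (t^T *m x) 0 0) @^-1` A)).
rewrite -[_ @^-1` _]setTI.
by apply: (measurable_dot t (X := id)) => //; exact: measurable_id.
Qed.

Section standardization.
Context d (T : measurableType d) (P : probability T R) (n : nat).
Variables (Y : T -> 'cV[R]_n) (C : 'M[R]_n).
Hypothesis LY : forall i, L4 P (fun w => Y w i 0).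
Hypotheses (uC : C \in unitmx) (CC : C *m C^T = variance_mx P Y).
Let Y0 w := Y w - mu1 P Y.
Let Z w := invmx C *m Y0 w.

Let LY0 i : L4 P (fun w => Y0 w i 0).
Proof.
under eq_fun do rewrite addmxE.
by apply: L4D => //; exact: L4_cst.
Qed.

Lemma center_mu1 : mu1 P Y0 = 0.
Proof.
apply/matrixP => i j; rewrite ord1 mu1E [RHS]mxE.
under eq_Rintegral do rewrite addmxE oppmxE.
rewrite RintegralB ?Rintegral_const -?mu1E ?subrr//; last exact: integrable_const.
exact: L4_integrable1.
Qed.

Lemma mulmx_mu1 p (A : 'M[R]_(p, n)) :
  mu1 P (fun w => A *m Y0 w) = 0.
Proof.
have := @mx_expectation_mul R d T P p n 1 1 A Y0 1%:M.
rewrite mulmx1 [mx_expectation P Y0]center_mu1 mulmx0 => <-.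
  by congr (mx_expectation P _); apply/funext => w; rewrite mulmx1.
by move=> i j; rewrite ord1; exact: L4_integrable1.
Qed.

Lemma standardized_mu1 : mu1 P Z = 0.
Proof. exact: mulmx_mu1. Qed.

Lemma standardized_variance : variance_mx P Z = 1%:M.
Proof.
rewrite /variance_mx standardized_mu1.
have -> : (fun w => (Z w - 0) *m (Z w - 0)^T) =
    (fun w => invmx C *m (Y0 w *m (Y0 w)^T) *m (invmx C)^T).
  by apply/funext => w; rewrite subr0 trmx_mul !mulmxA.
rewrite mx_expectation_mul; last first.
  by move=> i j; under eq_fun do rewrite col_rowE; exact: L4_integrable2.
rewrite -[mx_expectation P _]/(variance_mx P Y) -CC trmx_inv mulmxA mulVmx// mul1mx.
by rewrite mulmxV// unitmx_tr.
Qed.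

Lemma invmx_variance : invmx (variance_mx P Y) = (invmx C)^T *m invmx C.
Proof.
have uS : variance_mx P Y \in unitmx by rewrite -CC unitmx_mul unitmx_tr uC.
have E : variance_mx P Y *m ((invmx C)^T *m invmx C) = 1%:M.
  rewrite -CC trmx_inv -mulmxA (mulmxA C^T) mulmxV ?unitmx_tr// mul1mx.
  exact: mulmxV.
by rewrite -[RHS](mulKmx uS) E mulmx1.
Qed.

Let mahalanobisE w w' : (Y0 w)^T *m invmx (variance_mx P Y) *m Y0 w' =
  (Z w - mu1 P Z)^T *m invmx (variance_mx P Z) *m (Z w' - mu1 P Z).
Proof.
rewrite standardized_mu1 standardized_variance invmx1 mulmx1 !subr0.
by rewrite invmx_variance trmx_mul !mulmxA.
Qed.

Lemma mardia_skewness_standardized : mardia_skewness P Y = mardia_skewness P Z.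
Proof. by apply: eq_Rintegral => z _; rewrite -mahalanobisE. Qed.

Lemma mardia_kurtosis_standardized : mardia_kurtosis P Y = mardia_kurtosis P Z.
Proof.
by rewrite /mardia_kurtosis; congr (fine ('E_P[_])%E); apply/funext => w;
  rewrite -mahalanobisE.
Qed.

End standardization.

End affine_maps.

(** * Moments and Mardia's measures of the unified skew-normal law *)

(* In the last identity the informal text has the term
     - (1 + K) *m m3 *m tens_row m1^T 1
   instead of - m3 *m tens_row m1^T 1 *m (1 + K); that version is false for
   2 <= m (its right-hand side is not even symmetric), see NOTES.md. *)
Theorem proposition2 (R : realType) (d m : nat)
  (Obar : 'M[R]_d) (Delta : 'M[R]_(d, m)) (Gamma : 'M[R]_m)
  (tau : 'cV[R]_m) (xi : 'cV[R]_d) (omega : 'M[R]_d)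
  (disp : measure_display) (T : measurableType disp) (P : probability T R)
  (Y : {RV P >-> 'cV[R]_d})
  (disp' : measure_display) (T' : measurableType disp') (P' : probability T' R)
  (U : {RV P' >-> 'cV[R]_m}) (V : {RV P' >-> 'cV[R]_d})
  (C : 'M[R]_d) :
  (0 < d)%N -> (0 < m)%N ->
  correlation_mx (block_mx Obar Delta Delta^T Gamma) ->
  \rank (block_mx Obar Delta Delta^T Gamma) = (d + m)%N ->
  is_diag_mx omega -> (forall i, 0 < omega i i) ->
  SUN P Y xi omega Obar Delta tau Gamma ->
  truncated_mvnormal0 P' U tau Gamma ->
  mvnormal0 P' V 1%:M ->
  independent_rv P' U V ->
  let mu := mu1 P Y in
  let Sigma := variance_mx P Y in
  Sigma \in unitmx ->
  C \in unitmx -> C *m C^T = Sigma ->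
  let Omega := omega *m Obar *m omega in
  let Lambda := omega *m Delta *m invmx Gamma in
  let Psi := Omega - omega *m Delta *m invmx Gamma *m Delta^T *m omega in
  let Zt := fun w => invmx C *m (Y w - mu) in
  let U0 := fun w => U w - mu1 P' U in
  let Lambdat := invmx C *m Lambda in
  let Psit := invmx C *m Psi *m (invmx C)^T in
  let SigmaU := mu2 P' U0 in
  let S := Lambdat *m SigmaU *m Lambdat^T in
  let Q := Lambda^T *m invmx Sigma *m Lambda in
  let m1 := mu1 P' U in
  let m2 := mu2 P' U in
  let m3 := mu3 P' U in
  let m4 := mu4 P' U in
  (forall Psi_half : 'M[R]_d, is_pd_sqrtmx Psi Psi_half ->
    same_law P P' Zt
      (fun w => Lambdat *m U0 w + invmx C *m Psi_half *m V w)) /\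
  (forall Psit_half : 'M[R]_d, is_pd_sqrtmx Psit Psit_half ->
    same_law P P' Zt (fun w => Lambdat *m U0 w + Psit_half *m V w)) /\
  mu3 P Zt = (Lambdat *t Lambdat) *m mu3 P' U0 *m Lambdat^T /\
  mu4 P Zt =
    (Lambdat *t Lambdat) *m mu4 P' U0 *m (Lambdat *t Lambdat)^T
    + (1%:M + commutation_mx d d) *m (S *t Psit + Psit *t S + Psit *t Psit)
    + vec S *m (vec Psit)^T + vec Psit *m (vec S)^T
    + vec Psit *m (vec Psit)^T /\
  mardia_skewness P Y = mardia_skewness P Zt /\
  mardia_skewness P Zt =
    \tr ((Q *t Q) *m mu3 P' U0 *m Q *m (mu3 P' U0)^T) /\
  mardia_skewness P Zt =
    ((vec (mu3 P' U0))^T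
     *m ((Lambdat^T *m Lambdat)
         *t ((Lambdat^T *m Lambdat) *t (Lambdat^T *m Lambdat)))
     *m vec (mu3 P' U0)) 0 0 /\
  mardia_kurtosis P Y = mardia_kurtosis P Zt /\
  mardia_kurtosis P Zt =
    \tr ((Q *t Q) *m mu4 P' U0)
    + 2 * \tr (SigmaU *m Q) * \tr (Psi *m invmx Sigma)
    + (\tr (Psi *m invmx Sigma)) ^+ 2
    + 4 * \tr (SigmaU *m Lambda^T *m invmx Sigma *m Psi *m invmx Sigma
               *m Lambda)
    + 2 * \tr (Psi *m invmx Sigma *m Psi *m invmx Sigma) /\
  mu3 P' U0 =
    (1%:M + commutation_mx m m)
      *m (tens_col m1 (m1 *m m1^T) - tens_col m1 m2)
    - vec m2 *m m1^T + m3 /\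
  mu4 P' U0 =
    - 3 *: ((m1 *m m1^T) *t (m1 *m m1^T))
    + (1%:M + commutation_mx m m)
      *m ((m1 *m m1^T) *t m2 + m2 *t (m1 *m m1^T)
          - tens_col m1 1%:M *m m3^T)
    - m3 *m tens_row m1^T 1%:M *m (1%:M + commutation_mx m m)
    + vec m2 *m (tens_col m1 m1)^T + tens_col m1 m1 *m (vec m2)^T
    + m4.
Proof.
move=> _ _ [psdS _] rankS diag_omega _ SUNY truncU NV indUV mu Sigma uS uC CC.
move=> Omega Lambda Psi Zt U0 Lambdat Psit SigmaU S Q m1 m2 m3 m4.
have [_ psdG] := psdmx_block psdS.
have uG := dr_block_unitmx psdS rankS.
have omegaT : omega^T = omega.
  apply/matrixP => i j; rewrite mxE; have [->//|ij] := eqVneq i j.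
  move/is_diag_mxP : diag_omega => dO.
  by rewrite (dO i j)// (dO j i)// eq_sym.
have psdPsi : psdmx Psi := psdmx_Psi psdS uG omegaT.
have mY : measurable_fun setT Y by [].
have mU : measurable_fun setT U by [].
have mV : measurable_fun setT V by [].
have LU := L4_truncated mU psdG truncU.
have LU0 i : L4 P' (fun w => U0 w i 0).
  by under eq_fun do rewrite addmxE; apply: L4D => //; exact: L4_cst.
have mU0 : measurable_fun setT U0 by exact: measurable_addmx.
(* Psi need not be factored: the residual omega X0 - Lambda X1 of the vectors
   that represent Y is N(0, Psi), and on the product space it is independent
   of U. *)
have [d0 [T0 [P0 [X0 [X1 [NX _]]]]]] := SUNY.
pose H w := omega *m X0 w - Lambda *m X1 w.
have mH : measurable_fun setT H.
  rewrite (_ : H = fun w => omega *m X0 w + (- Lambda) *m X1 w); last first.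
    by apply/funext => w; rewrite mulNmx.
  by apply: measurable_addmx; exact: measurable_mulmxl.
have NH : mvnormal0 P0 H Psi := mvnormal0_residual psdS uG omegaT NX.
pose M := (P' \x P0)%E : probability _ R.
have mU1 : measurable_fun setT (fun z : T' * T0 => U z.1) by exact: measurableT_comp.
have mH2 : measurable_fun setT (fun z : T' * T0 => H z.2) by exact: measurableT_comp.
have truncU1 : truncated_mvnormal0 M (fun z => U z.1) tau Gamma.
  have [d3 [T3 [P3 [W [NW UE]]]]] := truncU.
  exists d3, T3, P3, W; split => // A mA.
  by rewrite -UE//; exact: same_law_fst.
have NH2 : mvnormal0 M (fun z => H z.2) Psi.
  apply: (same_law_mvnormal0_trans _ NH); exact: same_law_snd.
have YM : same_law P M Y (fun z => xi + Lambda *m U z.1 + H z.2).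
  exact: (SUN_additive psdS uG omegaT mU1 mH2 SUNY truncU1 NH2
    (independent_fst_snd P' P0 mU mH)).
have mxiU : measurable_fun setT (fun w => xi + Lambda *m U w).
  by apply: measurable_addmx => //; exact: measurable_mulmxl.
have LxiU i : L4 P' (fun w => (xi + Lambda *m U w) i 0).
  under eq_fun do rewrite addmxE.
  by apply: L4D; [exact: L4_cst|exact: L4_mulmx].
have LY := mixture_L4 mY mxiU mH LxiU psdPsi NH YM.
have muE : mu = xi + Lambda *m m1.
  rewrite /mu (mixture_mu1 mY mxiU mH LxiU psdPsi NH YM).
  apply/matrixP => i j; rewrite ord1 mu1E addmxE.
  under eq_Rintegral do rewrite addmxE.
  rewrite RintegralD ?Rintegral_const//; first last.
  - by apply: L4_integrable1; exact: L4_mulmx.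
  - exact: integrable_const.
  congr (_ + _); rewrite -(mu1E _ (fun w => Lambda *m U w)).
  have := @mx_expectation_mul R _ T' P' d m 1 1 Lambda U 1%:M.
  rewrite mulmx1 => <-.
    by congr (mx_expectation P' _ i 0); apply/funext => w; rewrite mulmx1.
  by move=> a b; rewrite ord1; exact: L4_integrable1.
pose g (y : 'cV[R]_d) := invmx C *m (y - mu).
have mg : measurable_fun setT g.
  by apply: measurable_mulmxl; apply: measurable_addmx => //; exact: measurable_id.
have gE u h : g (xi + Lambda *m u + h) = Lambdat *m (u - m1) + invmx C *m h.
  rewrite /g muE /Lambdat -mulmxA -mulmxDr; congr (_ *m _).
  by rewrite mulmxBr; apply/matrixP => i j; rewrite !addmxE !oppmxE !addmxE; ring.
have mZt : measurable_fun setT Zt by exact: (measurableT_comp mg mY).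
(* A = Psi_half and A = C *m Psit_half give the two representations. *)
have law_half (A : 'M[R]_d) : A *m A^T = Psi ->
    same_law P P' Zt (fun w => Lambdat *m U0 w + invmx C *m A *m V w).
  move=> AA.
  have mAV : measurable_fun setT (fun w => A *m V w) by exact: measurable_mulmxl.
  have NAV : mvnormal0 P' (fun w => A *m V w) Psi.
    by have := mvnormal0_mulmx A NV; rewrite mulmx1 AA.
  have indUAV : independent_rv P' U (fun w => A *m V w).
    move=> B1 B2 mB1 mB2.
    apply: (indUV B1 ((fun v => A *m v) @^-1` B2)) => //.
    rewrite -[_ @^-1` _]setTI.
    by apply: (measurable_mulmxl A (@measurable_id _ _ _)).
  have := SUN_additive psdS uG omegaT mU mAV SUNY truncU NAV indUAV.
  move=> /(same_law_comp mg) ZE B mB; rewrite [LHS](ZE _ mB).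
  by congr (P' _); apply/seteqP; split => w /=; rewrite gE mulmxA.
split.
  move=> Ph [[PhT _] PhPh]; apply: law_half.
  by rewrite PhT.
split.
  move=> Ph [[PhT _] PhPh].
  have AA : (C *m Ph) *m (C *m Ph)^T = Psi.
    rewrite trmx_mul PhT mulmxA -(mulmxA C) PhPh /Psit !mulmxA mulmxV// mul1mx.
    by rewrite trmx_inv -mulmxA mulVmx ?unitmx_tr// mulmx1.
  have := law_half _ AA.
  by rewrite mulmxA mulVmx// mul1mx.
pose A w := Lambdat *m U0 w.
pose G w := invmx C *m H w.
have mA : measurable_fun setT A by exact: measurable_mulmxl.
have mG : measurable_fun setT G by exact: measurable_mulmxl.
have LA : forall i, L4 P' (fun w => A w i 0) by exact: L4_mulmx.
have NG : mvnormal0 P0 G Psit by exact: mvnormal0_mulmx.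
have psdPsit : psdmx Psit.
  split; first by rewrite /Psit !trmx_mul trmxK psdPsi.1 mulmxA.
  move=> x; have := psdPsi.2 ((invmx C)^T *m x).
  by rewrite /Psit trmx_mul trmxK !mulmxA.
have ZM : same_law P M Zt (fun z => A z.1 + G z.2).
  move=> B mB; rewrite [LHS](same_law_comp mg YM mB).
  by congr (M _); apply/seteqP; split => z /=; rewrite gE.
have A1 : mu1 P' A = 0 by exact: mulmx_mu1.
have LZ := mixture_L4 mZt mA mG LA psdPsit NG ZM.
have mu3Z : mu3 P Zt = (Lambdat *t Lambdat) *m mu3 P' U0 *m Lambdat^T.
  by rewrite (mixture_mu3 mZt mA mG LA psdPsit NG ZM A1) mu3_mulmx.
have SE : mu2 P' A = S by rewrite mu2_mulmx.
have mu4Z : mu4 P Zt =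
    (Lambdat *t Lambdat) *m mu4 P' U0 *m (Lambdat *t Lambdat)^T
    + (1%:M + commutation_mx d d) *m (S *t Psit + Psit *t S + Psit *t Psit)
    + vec S *m (vec Psit)^T + vec Psit *m (vec S)^T
    + vec Psit *m (vec Psit)^T.
  by rewrite (mixture_mu4 mZt mA mG LA psdPsit NG ZM A1) SE mu4_mulmx.
have Z1 : mu1 P Zt = 0 := standardized_mu1 C LY.
have Z2 : variance_mx P Zt = 1%:M := standardized_variance LY uC CC.
have iS : invmx Sigma = (invmx C)^T *m invmx C := invmx_variance uC CC.
have LambdatT : Lambdat^T = Lambda^T *m (invmx C)^T := trmx_mul _ _.
have QE : Q = Lambdat^T *m Lambdat.
  by rewrite LambdatT /Q iS /Lambdat !mulmxA.
have skew : mardia_skewness P Zt =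
    \tr ((Q *t Q) *m mu3 P' U0 *m Q *m (mu3 P' U0)^T).
  by rewrite mardia_skewness_mu3// mu3Z mxtrace_third_moment -QE.
have kurt : mardia_kurtosis P Zt =
    \tr ((Q *t Q) *m mu4 P' U0)
    + 2 * \tr (SigmaU *m Q) * \tr (Psi *m invmx Sigma)
    + (\tr (Psi *m invmx Sigma)) ^+ 2
    + 4 * \tr (SigmaU *m Lambda^T *m invmx Sigma *m Psi *m invmx Sigma
               *m Lambda)
    + 2 * \tr (Psi *m invmx Sigma *m Psi *m invmx Sigma).
  rewrite mardia_kurtosis_mu4// mu4Z -!(addrA ((Lambdat *t _) *m _ *m _)).
  rewrite mxtraceD mxtrace_tens_congr -QE mxtrace_isserlis; last 2 first.
  - by apply/matrixP => i j; rewrite mxE -SE; exact: mu2C.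
  - exact: psdPsit.1.
  rewrite /S /Psit mxtrace_congr_low mxtrace_congr mxtrace_congr2.
  by rewrite mxtrace_congr_low_congr -iS -/Q !addrA.
split; first exact: mu3Z.
split; first exact: mu4Z.
split; first exact: mardia_skewness_standardized.
split; first exact: skew.
split.
  rewrite skew -QE -[in RHS]mulmxA tens_mul_vec dot_vec.
  have QT : Q^T = Q by rewrite QE trmx_mul trmxK.
  by rewrite -[RHS]mxtrace_tr trmx_mul trmxK QT mxtrace_mulC.
split; first exact: mardia_kurtosis_standardized.
split; first exact: kurt.
split; first exact: mu3_center.
exact: mu4_center.
Qed.
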